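(* In the notation of the context, the lattice $\Gamma_\ell$ is the Niemeier lattice $N(A_1^{24})$. Its $48$ roots correspond to the points off $\ell$ collinear with a point of $\ell$. The three points of $\ell$ partition its $24$ root pairs into a trio of Golay octads.
   Context: Let $L$ be an even positive-definite integral lattice with $\operatorname{rk}L=26$, $\det L=3$, $\min L=4$, and write $L^\#/L=\{0,C_+,C_-\}$, $C_-=-C_+$, where $L^\#$ is the dual lattice. The set $X=\{x\in C_+:(x,x)=8/3\}$ has $819$ elements and is the point set of a generalized hexagon of order $(2,8)$ (incidence graph of diameter $6$ and girth $12$, three points on each line, nine lines through each point) whose lines are the triples $\{x,y,z\}\subset X$ with $x+y+z=0$; two points are collinear if they lie on a common line. Let $c$ be a vector of norm $c^2=3$, orthogonal to $L\otimes\mathbf R$. The gluing $$M=(L\oplus\mathbf Zc)\cup(C_+\oplus(c/3+\mathbf Zc))\cup(C_-\oplus(-c/3+\mathbf Zc))$$ is an odd unimodular lattice of rank $27$ and minimum $3$ in which $c$ is characteristic. Fix a line $\ell=\{x,y,z\}$ of the hexagon and put $u=x+c/3$, $v=y+c/3$, $w=z+c/3$ in $M$; then $u+v+w=c$, $u^2=v^2=w^2=3$ and $(u,v)=(v,w)=(w,u)=-1$. Let $S_\ell=\langle u,v,w\rangle_{\mathbf Z}$ and $K_\ell=S_\ell^\perp\cap M$. The vectors $e_u=(u-c)/2$, $e_v=(v-c)/2$, $e_w=(w-c)/2$ are orthonormal; let $I_\ell=\mathbf Ze_u\oplus\mathbf Ze_v\oplus\mathbf Ze_w\cong\mathbf Z^3$,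 so that $S_\ell\subset I_\ell\subset S_\ell^\#$ and $I_\ell/S_\ell\cong\mathbf F_2^2$. The lattice $S_\ell$ is primitive in $M$; let $\psi:S_\ell^\#/S_\ell\to K_\ell^\#/K_\ell$ be the anti-isometry of discriminant bilinear forms defined by the gluing in $M$, that is, $M=\{s+k:s\in S_\ell^\#,\ k\in K_\ell^\#,\ \bar k=\psi(\bar s)\}$. Define $$\Gamma_\ell=\{a\in K_\ell^\#:\bar a\in\psi(I_\ell/S_\ell)\},$$ an integral unimodular lattice with $[\Gamma_\ell:K_\ell]=4$. Roots are vectors of norm $2$; a root pair is a set $\{\pm r\}$ with $r$ a root. The Niemeier lattice $N(A_1^{24})$ is the even unimodular lattice of rank $24$ with root system $A_1^{24}$: with pairwise orthogonal vectors $r_1,\dots,r_{24}$ of norm $2$ and the binary Golay code $\mathcal G\subset\mathbf F_2^{24}$, it is $\{\frac12\sum_i a_ir_i:a_i\in\mathbf Z,\ (a_i\bmod2)\in\mathcal G\}$, and its roots are the vectors $\pm r_i$. The $24$ coordinates of the Golay code are thus identified with the $24$ root pairs. A Golay octad is the support of a codeword of weight $8$, and a trio is a partition of the $24$ coordinates into three octads. *)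

(* Defs.v *)
From HB Require Import structures.
From mathcomp Require Import all_boot all_order all_algebra.
From mathcomp Require Import all_classical all_reals.

Set Implicit Arguments.
Unset Strict Implicit.
Unset Printing Implicit Defensive.

Import Order.TTheory GRing.Theory Num.Theory.

Local Open Scope classical_set_scope.
Local Open Scope card_scope.
Local Open Scope ring_scope.

(** * Lattices in the Euclidean space ['rV[R]_n] *)

Definition dot (R : realType) (n : nat) (a b : 'rV[R]_n) : R :=
  (a *m b^T) 0 0.

Definition sqnorm (R : realType) (n : nat) (a : 'rV[R]_n) : R := dot a a.

Definition Zspan (R : realType) (n : nat) (A : set 'rV[R]_n) : set 'rV[R]_n :=
  [set v | exists (k : nat) (m : 'I_k -> int) (t : 'I_k -> 'rV[R]_n),
     (forall i, A (t i)) /\ v = \sum_i (m i)%:~R *: t i].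

Definition Rspan (R : realType) (n : nat) (A : set 'rV[R]_n) : set 'rV[R]_n :=
  [set v | exists (k : nat) (m : 'I_k -> R) (t : 'I_k -> 'rV[R]_n),
     (forall i, A (t i)) /\ v = \sum_i m i *: t i].

Definition lattice_basis (R : realType) (n m : nat) (L : set 'rV[R]_n)
    (B : 'M[R]_(m, n)) : Prop :=
  row_free B /\ L = Zspan [set row i B | i in [set: 'I_m]].

Definition gram (R : realType) (n m : nat) (B : 'M[R]_(m, n)) : 'M[R]_m :=
  B *m B^T.

Definition integral_lattice (R : realType) (n : nat) (L : set 'rV[R]_n) : Prop :=
  forall a b, L a -> L b -> dot a b \is a Num.int.

Definition even_lattice (R : realType) (n : nat) (L : set 'rV[R]_n) : Prop :=
  forall a, L a -> exists k : int, sqnorm a = 2 * k%:~R.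

Definition lattice_min (R : realType) (n : nat) (L : set 'rV[R]_n) (d : R) : Prop :=
  (exists a, [/\ L a, a != 0 & sqnorm a = d]) /\
  (forall a, L a -> a != 0 -> d <= sqnorm a).

(* The lattice need not have full rank in the ambient space, so its dual is
   taken inside its real span. *)
Definition dual_lattice (R : realType) (n : nat) (L : set 'rV[R]_n) : set 'rV[R]_n :=
  [set a | Rspan L a /\ forall b, L b -> dot a b \is a Num.int].

Definition coset (R : realType) (n : nat) (A : set 'rV[R]_n) (a : 'rV[R]_n) :
    set 'rV[R]_n :=
  [set a + b | b in A].

(* The quotient A / B, as a set of cosets. *)
Definition quot (R : realType) (n : nat) (A B : set 'rV[R]_n) : set (set 'rV[R]_n) :=
  [set coset B a | a in A].

(** * Generalized hexagons *)

Section Graphs.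
Local Open Scope nat_scope.

Definition dist_le (T : eqType) (e : rel T) (k : nat) (a b : T) : Prop :=
  exists p : seq T, [/\ path e a p, last a p = b & size p <= k].

Definition has_diameter (T : eqType) (vert : set T) (e : rel T) (d : nat) : Prop :=
  (forall a b, vert a -> vert b -> dist_le e d a b) /\
  (exists a b, [/\ vert a, vert b & forall k, dist_le e k a b -> d <= k]).

Definition has_girth (T : eqType) (e : rel T) (g : nat) : Prop :=
  (exists s : seq T, [/\ 3 <= size s, ucycle e s & size s = g]) /\
  (forall s : seq T, 3 <= size s -> ucycle e s -> g <= size s).

End Graphs.

(* Vertices and adjacency of the (bipartite) incidence graph. *)
Definition inc_vert (P : choiceType) (pts : set P) (lns : set (set P)) :
    set (P + set P)%type :=
  [set a | match a with inl p => pts p | inr l => lns l end].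

Definition inc_adj (P : choiceType) (pts : set P) (lns : set (set P)) :
    rel (P + set P)%type :=
  fun a b => match a, b with
  | inl p, inr l | inr l, inl p => `[< [/\ pts p, lns l & l p] >]
  | _, _ => false
  end.

Definition generalized_hexagon (P : choiceType) (pts : set P) (lns : set (set P))
    (s t : nat) : Prop :=
  [/\ forall l, lns l -> l `<=` pts,
      forall l, lns l -> l #= `I_s.+1,
      forall p, pts p -> [set l | lns l /\ l p] #= `I_t.+1,
      has_diameter (inc_vert pts lns) (inc_adj pts lns) 6 &
      has_girth (inc_adj pts lns) 12].

Definition collinear (P : Type) (lns : set (set P)) (p q : P) : Prop :=
  exists l, [/\ lns l, l p & l q].

(** * The hexagon in the coset [Cp] *)

Definition hex_points (R : realType) (n : nat) (Cp : set 'rV[R]_n) : set 'rV[R]_n :=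
  [set a | Cp a /\ sqnorm a = 8 / 3].

Definition line_triple (R : realType) (n : nat) (X : set 'rV[R]_n)
    (x y z : 'rV[R]_n) : Prop :=
  [/\ X x, X y, X z & x + y + z = 0].

Definition hex_lines (R : realType) (n : nat) (X : set 'rV[R]_n) :
    set (set 'rV[R]_n) :=
  [set l | exists x y z, line_triple X x y z /\ l = [set x; y; z]].

(** * The gluing [M] and the lattices attached to a line *)

(* A + (t + Z c) *)
Definition layer (R : realType) (n : nat) (c : 'rV[R]_n) (A : set 'rV[R]_n)
    (t : 'rV[R]_n) : set 'rV[R]_n :=
  [set v | exists2 a, A a & exists k : int, v = a + (t + k%:~R *: c)].

Definition glueM (R : realType) (n : nat) (L Cp Cm : set 'rV[R]_n) (c : 'rV[R]_n) :
    set 'rV[R]_n :=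
  layer c L 0 `|` layer c Cp (3^-1 *: c) `|` layer c Cm (- (3^-1 *: c)).

Definition lift3 (R : realType) (n : nat) (c x : 'rV[R]_n) : 'rV[R]_n :=
  x + 3^-1 *: c.

Definition evec (R : realType) (n : nat) (c x : 'rV[R]_n) : 'rV[R]_n :=
  2^-1 *: (lift3 c x - c).

Definition Sline (R : realType) (n : nat) (c x y z : 'rV[R]_n) : set 'rV[R]_n :=
  Zspan [set lift3 c x; lift3 c y; lift3 c z].

Definition Iline (R : realType) (n : nat) (c x y z : 'rV[R]_n) : set 'rV[R]_n :=
  Zspan [set evec c x; evec c y; evec c z].

Definition Kline (R : realType) (n : nat) (M : set 'rV[R]_n) (c x y z : 'rV[R]_n) :
    set 'rV[R]_n :=
  [set a | M a /\ forall s, Sline c x y z s -> dot a s = 0].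

(* The gluing map S^#/S -> K^#/K of M, on cosets: it sends the class of s to
   the set of all k in K^# with s + k in M, which is one class modulo K. *)
Definition psi (R : realType) (n : nat) (M K : set 'rV[R]_n) (C : set 'rV[R]_n) :
    set 'rV[R]_n :=
  [set k | dual_lattice K k /\ exists2 s, C s & M (s + k)].

Definition Gamma (R : realType) (n : nat) (M : set 'rV[R]_n) (c x y z : 'rV[R]_n) :
    set 'rV[R]_n :=
  let S := Sline c x y z in
  let I := Iline c x y z in
  let K := Kline M c x y z in
  [set a | dual_lattice K a /\ [set psi M K C | C in quot I S] (coset K a)].

Definition lattice_roots (R : realType) (n : nat) (A : set 'rV[R]_n) : set 'rV[R]_n :=
  [set a | A a /\ sqnorm a = 2].

Definition pm (R : realType) (n : nat) (a : 'rV[R]_n) : set 'rV[R]_n :=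
  [set a; - a].

(** * The binary Golay code and the Niemeier lattice of type [A_1^24] *)

(* The cyclic [23,12,7] code (polynomials of degree < 23 divisible by the
   generator), extended by an overall parity bit in the last coordinate. *)
Definition golay_gen : {poly 'F_2} :=
  'X^11 + 'X^10 + 'X^6 + 'X^5 + 'X^4 + 'X^2 + 1.

Definition golay (a : 'rV['F_2]_24) : bool :=
  (golay_gen %| \poly_(i < 23) a 0 (inord i))%R && (\sum_i a 0 i == 0).

Definition golay_octad (O : {set 'I_24}) : Prop :=
  exists a : 'rV['F_2]_24,
    [/\ golay a, O = finset (fun i => a 0 i != 0) & #|O| = 8%N].

Definition golay_trio (P : {set {set 'I_24}}) : Prop :=
  [/\ finset.partition P (finset.setTfor 'I_24), #|P| = 3%N &
      forall O, O \in P -> golay_octad O].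

(* [A] is N(A_1^24), with coordinate i of the Golay code given by the root
   pair of r i. *)
Definition niemeier_A1_24 (R : realType) (n : nat) (r : 'I_24 -> 'rV[R]_n)
    (A : set 'rV[R]_n) : Prop :=
  (forall i j, dot (r i) (r j) = if i == j then 2 else 0) /\
  A = [set v | exists a : 'rV[int]_24,
         golay (map_mx intr a) /\ v = 2^-1 *: \sum_i (a 0 i)%:~R *: r i].

(** * From points of the hexagon to roots *)

(* Points off the line {x, y, z} collinear with t. *)
Definition nbrs (R : realType) (n : nat) (X : set 'rV[R]_n)
    (x y z t : 'rV[R]_n) : set 'rV[R]_n :=
  [set p | [/\ X p, ~ [set x; y; z] p & collinear (hex_lines X) p t]].

(* The component in K^# of p + c/3 in M, i.e. its orthogonal projection along
   the real span of S, of which the evec's form an orthonormal basis. *)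
Definition Kproj (R : realType) (n : nat) (c x y z p : 'rV[R]_n) : 'rV[R]_n :=
  let q := lift3 c p in
  q - (dot q (evec c x) *: evec c x + dot q (evec c y) *: evec c y
       + dot q (evec c z) *: evec c z).

(* The coordinates i whose root pair comes from a point collinear with t. *)
Definition block (R : realType) (n : nat) (X : set 'rV[R]_n)
    (c x y z : 'rV[R]_n) (r : 'I_24 -> 'rV[R]_n) (t : 'rV[R]_n) : {set 'I_24} :=
  finset (fun i =>
    `[< [set pm (Kproj c x y z p) | p in nbrs X x y z t] (pm (r i)) >]).

(* Main.v *)
(** Every point of the hexagon collinear with a point [x] of the line gives, after
    projection along the line, a root of [Gamma]. Inner products of hexagon points
    are read off the hexagon: the third point of a line through [q] splits a sum
    in two, and since the incidence graph has no 8-cycle this leaves a single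
    possibility. Hence the roots obtained are pairwise orthogonal or opposite, and
    the eight further lines through each of the three points give 24 orthogonal
    ones. As [Gamma] is even and self-dual, with no other roots, its glue code over
    these is a doubly even self-dual code of length 24 without words of weight 4,
    and such a code is the Golay code up to a permutation of the coordinates.
    Doubling the projection of a point far from [x] and [y] but at distance 2 from
    [z] gives a vector of [Gamma] meeting the roots of [z] evenly and the others
    oddly; so the complements of the three blocks of roots are Golay words, and
    the blocks have weight 8 because their weights are positive and not 4.

    For the uniqueness of the Golay code, any five coordinates lie in an octad of
    the code. Adding octads one at a time, each through five well chosen
    coordinates, the weight conditions leave a single choice up to permutations
    of the coordinates preserving the words found before; so the twelve cyclic
    shifts of the generator polynomial can be found in the code one after the
    other. *)
Require Import Defs.
From HB Require Import structures.
From mathcomp Require Import all_boot all_order all_algebra all_fingroup mxabelem.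
From mathcomp Require Import zify ring lra.

Set Implicit Arguments.
Unset Strict Implicit.
Unset Printing Implicit Defensive.

Import Order.TTheory GRing.Theory Num.Theory.

Local Open Scope ring_scope.

(** * The binary Golay code *)

Definition xorw (s t : seq bool) : seq bool :=
  [seq p.1 (+) p.2 | p <- zip s t].

Fixpoint xor_span (ws : seq (seq bool)) : seq (seq bool) :=
  if ws is w :: ws' then
    let t := xor_span ws' in t ++ [seq xorw w v | v <- t]
  else [:: nseq 24 false].

(** The possible weights in a doubly even code without words of weight 4; zero is kept for the zero
    word. *)
Definition admissible_weight (m : nat) : bool := (4 %| m)%N && (m != 4)%N.

Fixpoint supersets (mask : seq bool) (m : nat) : seq (seq bool) :=
  if mask is b :: mask' then
    (if b then [::] else [seq false :: s | s <- supersets mask' m]) ++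
    (if m is m'.+1 then [seq true :: s | s <- supersets mask' m'] else [::])
  else if m == 0%N then [:: [::]] else [::].

(** The offsets are the exponents in [golay_gen]. There are seven of them, so the parity bit is
    always set; for [k < 12] the shift stays below position 23 and never wraps around. *)
Definition golay_row (k : nat) : seq bool :=
  mkseq (fun j => (j \in [seq (k + d)%N | d <- [:: 0; 2; 4; 5; 6; 10; 11]%N])
                  || (j == 23)%N) 24.

Definition golay_rows (k : nat) : seq (seq bool) := map golay_row (iota 0 k).

(* Five coordinates of [golay_row k], found by search, that make [forced_octad]
   hold. *)
Definition pivots (k : nat) : seq nat :=
  if k == 4 then [:: 4; 6; 9; 14; 23]%N else
  if k == 5 then [:: 5; 7; 10; 11; 15]%N else
  if (0 < k < 4)%N then [seq (k + d)%N | d <- [:: 0; 2; 4; 5; 10]%N]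
  else [seq (k + d)%N | d <- [:: 0; 2; 4; 5; 6]%N].

(** The columns of the matrix with rows [ws] and [w]. Two words with the same columns up to order
    differ by a coordinate permutation that fixes every word of [ws]. *)
Definition signatures (ws : seq (seq bool)) (w : seq bool) : seq (seq bool) :=
  [seq [seq nth false v j | v <- rcons ws w] | j <- iota 0 24].

Definition pivot_mask (k : nat) : seq bool := [seq j \in pivots k | j <- iota 0 24].

(* Up to a permutation of the coordinates fixing the words of [ws], [w] is the
   only octad containing [mask] that has admissible distances to the span of
   [ws]. The condition on [find] is an [all] that [vm_compute] evaluates lazily. *)
Definition forced_octad (ws : seq (seq bool)) (mask w : seq bool) : bool :=
  let t := xor_span ws in
  let bad o v := ~~ admissible_weight (count id (xorw o v)) in
  all (fun o => perm_eq (signatures ws o) (signatures ws w))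
    [seq o <- supersets mask 8 | find (bad o) t == size t].

Definition bitvec (w : seq bool) : 'rV['F_2]_24 := \row_i (nth false w i)%:R.

Definition supp (a : 'rV['F_2]_24) : {set 'I_24} := [set i | a 0 i != 0].

Lemma F2_nat (x : 'F_2) : x = (x != 0)%:R.
Proof. by case: x => [[|[|m]] //= lt_m]; apply: val_inj. Qed.

Lemma F2_natD (b c : bool) : (b (+) c)%:R = b%:R + c%:R :> 'F_2.
Proof. by case: b; case: c; apply: val_inj. Qed.

Lemma F2_nat_eq0 (b : bool) : (b%:R == 0 :> 'F_2) = ~~ b.
Proof. by case: b. Qed.

Lemma bitvecK (a : 'rV['F_2]_24) :
  bitvec [seq a 0 (inord j) != 0 | j <- iota 0 24] = a.
Proof.
apply/rowP=> i; rewrite mxE (nth_map 0%N) ?size_iota // nth_iota // add0n.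
by rewrite inord_val -F2_nat.
Qed.

Lemma card_supp_bitvec (w : seq bool) : size w = 24 -> #|supp (bitvec w)| = count id w.
Proof.
move=> sz_w; rewrite cardE size_filter -[w in RHS](mkseq_nth false) sz_w.
rewrite /mkseq -val_enum_ord -map_comp count_map enumT; apply/eq_count => i.
by rewrite /= inE mxE F2_nat_eq0 negbK.
Qed.

Lemma bitvec_xor (v w : seq bool) : size v = 24 -> size w = 24 ->
  bitvec (xorw v w) = bitvec v + bitvec w.
Proof.
move=> sz_v sz_w; apply/rowP => i; rewrite !mxE -F2_natD.
by rewrite (nth_map (false, false)) ?size_zip ?sz_v ?sz_w // nth_zip ?sz_v.
Qed.

Lemma size_xorw (v w : seq bool) : size v = 24 -> size w = 24 -> size (xorw v w) = 24.
Proof. by move=> sz_v sz_w; rewrite size_map size_zip sz_v sz_w. Qed.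

Lemma mem_supersets (mask s : seq bool) (m : nat) :
  size s = size mask -> count id s = m ->
  (forall j, nth false mask j -> nth false s j) -> s \in supersets mask m.
Proof.
elim: mask s m => [|b mask IH] [|a s] m //=; first by move=> _ <-.
move=> [sz_s] def_m sub; rewrite mem_cat.
have IHs m' : count id s = m' -> s \in supersets mask m'.
  by move=> def_m'; apply: IH => // j; apply: (sub j.+1).
case: a def_m sub => /= def_m sub.
  by rewrite -def_m orbC add1n map_f ?IHs.
by case: b sub => [/(_ 0%N isT) //|_]; rewrite map_f ?IHs.
Qed.

Lemma xor_span_sub (C : {set 'rV['F_2]_24}) (ws : seq (seq bool)) :
  0 \in C -> {in C &, forall a b, a + b \in C} ->
  (forall w, w \in ws -> size w = 24 /\ bitvec w \in C) ->
  forall w, w \in xor_span ws -> size w = 24 /\ bitvec w \in C.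
Proof.
move=> C0 CD; elim: ws => [|v ws IH] Cws w /=.
  rewrite inE => /eqP->; split=> //.
  suff -> : bitvec (nseq 24 false) = 0 by [].
  by apply/rowP=> i; rewrite !mxE nth_nseq if_same.
have [sz_v Cv] := Cws v (mem_head _ _).
have {}IH u : u \in xor_span ws -> size u = 24 /\ bitvec u \in C.
  by apply: IH => t t_ws; apply: Cws; rewrite inE t_ws orbT.
rewrite mem_cat => /orP[/IH //|/mapP[u /IH[sz_u Cu] ->]].
by rewrite size_xorw ?bitvec_xor ?CD.
Qed.

Lemma nth_signatures ws w j i : (j < 24)%N ->
  nth false (nth [::] (signatures ws w) j) i = nth false (nth [::] (rcons ws w) i) j.
Proof.
move=> lt_j; rewrite (nth_map 0%N) ?size_iota // nth_iota // add0n.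
have [lt_i|le_i] := ltnP i (size (rcons ws w)); first by rewrite (nth_map [::]).
by rewrite !nth_default // ?size_map // nth_default.
Qed.

Lemma perm_signatures (ws : seq (seq bool)) (v w : seq bool) :
  perm_eq (signatures ws v) (signatures ws w) ->
  exists t : 'S_24, col_perm t (bitvec w) = bitvec v /\
    forall u, u \in ws -> col_perm t (bitvec u) = bitvec u.
Proof.
have sz_sig u : size (signatures ws u) == 24 by rewrite size_map size_iota.
case/(@tuple_permP _ _ _ (Tuple (sz_sig w))) => t def_t.
have sigE (j : 'I_24) : nth [::] (signatures ws v) j = nth [::] (signatures ws w) (t j).
  rewrite def_t (nth_map j) ?size_enum_ord // nth_ord_enum.
  by rewrite (tnth_nth [::]).
have permE i : col_perm t (bitvec (nth [::] (rcons ws w) i)) =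
    bitvec (nth [::] (rcons ws v) i).
  by apply/rowP => j; rewrite !mxE -!nth_signatures // -sigE.
exists t; split; first by have := permE (size ws); rewrite !nth_rcons ltnn eqxx.
move=> u u_ws; have := permE (index u ws).
by rewrite !nth_rcons index_mem u_ws nth_index.
Qed.

(** The last condition is the covering half of the Steiner system S(5,8,24) formed by the octads. *)
Definition octad_code (C : {set 'rV['F_2]_24}) : Prop :=
  [/\ 0 \in C, {in C &, forall a b, a + b \in C},
      forall a, a \in C -> admissible_weight #|supp a| &
      forall F : {set 'I_24}, #|F| = 5 ->
        exists c, [/\ c \in C, #|supp c| = 8 & F \subset supp c]].

Lemma supp_col_perm (s : 'S_24) a : supp (col_perm s a) = s @^-1: supp a.
Proof. by apply/setP => i; rewrite !inE mxE. Qed.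

Lemma octad_code_perm (C : {set 'rV['F_2]_24}) (s : 'S_24) :
  octad_code C -> octad_code [set a | col_perm s a \in C].
Proof.
case=> C0 CD Cwt C5; have s_inj := @perm_inj _ s.
have card_s (A : {set 'I_24}) : #|s @^-1: A| = #|A|.
  by rewrite -[in RHS](card_preimset A s_inj).
split.
- by rewrite inE linear0.
- by move=> a b; rewrite !inE linearD; apply: CD.
- by move=> a; rewrite inE => /Cwt; rewrite supp_col_perm card_s.
move=> F F5; have [|c [Cc c8 sFc]] := C5 (s @^-1: F); first by rewrite card_s.
exists (col_perm s^-1 c).
rewrite inE -col_permM mulgV col_perm1 supp_col_perm; split=> //.
  by rewrite card_preimset //; apply: perm_inj.
apply/subsetP=> i Fi; have := subsetP sFc (s^-1 i)%g.
by rewrite !inE permKV; apply.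
Qed.

Lemma forced_octadP (ws : seq (seq bool)) (mask w o : seq bool) :
  forced_octad ws mask w -> o \in supersets mask 8 ->
  (forall v, v \in xor_span ws -> admissible_weight (count id (xorw o v))) ->
  perm_eq (signatures ws o) (signatures ws w).
Proof.
move=> /allP/(_ o) forced in_o wt_o; apply: forced.
rewrite mem_filter in_o andbT eqn_leq find_size leqNgt -has_find -all_predC.
by apply/allP => v /wt_o; rewrite /= negbK.
Qed.

(** The finite search behind uniqueness: at each of the twelve stages, the octads through the pivots
    that are compatible with the rows already found all have the same columns up to order. *)
Lemma golay_rows_forced :
  all (fun k => forced_octad (golay_rows k) (pivot_mask k) (golay_row k)) (iota 0 12).
Proof. by vm_compute. Qed.

(** The octad of [C] through the pivots has the same signatures as row [k]; the resulting
    permutation carries row [k] to that octad and leaves the earlier rows in place. *)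
Lemma octad_code_step (C : {set 'rV['F_2]_24}) (k : nat) : octad_code C -> (k < 12)%N ->
  (forall i, (i < k)%N -> bitvec (golay_row i) \in C) ->
  exists s : 'S_24, forall i, (i < k.+1)%N -> col_perm s (bitvec (golay_row i)) \in C.
Proof.
case=> C0 CD Cwt C5 lt_k Ck.
have [|c [Cc c8 sFc]] := C5 [set i : 'I_24 | val i \in pivots k].
  rewrite cardsE cardE size_filter -enumT -(count_map val (mem (pivots k))) val_enum_ord.
  by move: k lt_k {Ck}; do 12![case=> //].
set o := [seq c 0 (inord j) != 0 | j <- iota 0 24].
have def_c : bitvec o = c by exact: bitvecK.
have sz_o : size o = 24 by rewrite size_map size_iota.
have Ct := @xor_span_sub C (golay_rows k) C0 CD.
have {}Ct w : w \in xor_span (golay_rows k) -> size w = 24 /\ bitvec w \in C.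
  apply: Ct => u /mapP[i]; rewrite mem_iota add0n => lt_i ->.
  by rewrite size_mkseq; split=> //; apply: Ck.
have /allP/(_ k) := golay_rows_forced; rewrite mem_iota => /(_ lt_k) forced.
have/(_ _ _)/Wrap[||] := forced_octadP (o := o) forced.
- apply: mem_supersets; first by rewrite sz_o size_map size_iota.
    by rewrite -card_supp_bitvec // def_c.
  move=> j; have [lt_j|le_j] := ltnP j 24; last by rewrite nth_default // size_map size_iota.
  rewrite !(nth_map 0%N) ?size_iota // !nth_iota // add0n => Fj.
  by have := subsetP sFc (inord j); rewrite inE /= inordK // => /(_ Fj); rewrite inE.
- move=> w /Ct[sz_w Cw].
  by rewrite -card_supp_bitvec ?size_xorw // bitvec_xor // def_c Cwt ?CD.
case/perm_signatures => t [tk t_lt]; exists t => i.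
rewrite ltnS leq_eqVlt => /predU1P[->|lt_i]; first by rewrite tk def_c.
by rewrite t_lt ?Ck // map_f // mem_iota.
Qed.

(** Induction on the number of rows: replacing [C] by a permuted copy makes the rows found so far
    honest members, so the step applies, and the permutations compose. *)
Lemma octad_code_rows (C : {set 'rV['F_2]_24}) : octad_code C ->
  exists s : 'S_24, forall i, (i < 12)%N -> col_perm s (bitvec (golay_row i)) \in C.
Proof.
move=> codeC; suff: forall k, (k <= 12)%N -> exists s : 'S_24,
  forall i, (i < k)%N -> col_perm s (bitvec (golay_row i)) \in C by apply.
elim=> [|k IH] lt_k; first by exists 1%g.
have [s Cs] := IH (ltnW lt_k).
have [i lt_i|t Ct] := octad_code_step (octad_code_perm s codeC) lt_k.
  by rewrite inE Cs.
by exists (s * t)%g => i /Ct; rewrite inE col_permM.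
Qed.

(** * Doubly even self-dual codes of length 24 *)

Lemma mulmx_trE (a b : 'rV['F_2]_24) :
  a *m b^T = (#|supp a :&: supp b|%:R)%:M.
Proof.
apply/matrixP => i j; rewrite !ord1 !mxE eqxx mulr1n -sum1_card natr_sum.
rewrite [RHS]big_mkcond; apply: eq_bigr => l _; rewrite !mxE !inE.
by rewrite [a 0 l]F2_nat [b 0 l]F2_nat -natrM mulnb !F2_nat_eq0 !negbK; case: (_ && _).
Qed.

Lemma card_suppD (a b : 'rV['F_2]_24) :
  (#|supp (a + b)| + 2 * #|supp a :&: supp b| = #|supp a| + #|supp b|)%N.
Proof.
have -> : supp (a + b) = (supp a :\: supp b) :|: (supp b :\: supp a).
  apply/setP => i; rewrite !inE mxE [a 0 i]F2_nat [b 0 i]F2_nat -F2_natD !F2_nat_eq0.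
  by case: (_ == _); case: (_ == _).
rewrite -(cardsID (supp b) (supp a)) -(cardsID (supp a) (supp b)) (setIC (supp b)).
rewrite cardsU (_ : _ :&: _ = set0) ?cards0; last first.
  by apply/setP => i; rewrite !inE; do 2 case: (_ == _).
lia.
Qed.

Lemma F2_natr_eq0 m : (m%:R == 0 :> 'F_2) = ~~ odd m.
Proof. by rewrite -dvdn2 (dvdn_pcharf (pchar_Fp (isT : prime 2))). Qed.

(** Only the inclusion of the dual in [C] is listed; the reverse inclusion follows from the weights,
    as [doubly_even_orthogonal] shows. *)
Definition doubly_even_self_dual (C : {set 'rV['F_2]_24}) : Prop :=
  [/\ {in C &, forall a b, a + b \in C}, forall a, a \in C -> admissible_weight #|supp a| &
      forall a, (forall b, b \in C -> a *m b^T = 0) -> a \in C].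

(** In |a + b| + 2 |a meet b| = |a| + |b| the three weights are divisible by 4, so the overlap is
    even. *)
Lemma doubly_even_orthogonal C a b :
  doubly_even_self_dual C -> a \in C -> b \in C -> a *m b^T = 0.
Proof.
case=> CD Cwt _ Ca Cb; rewrite mulmx_trE.
suff /eqP-> : #|supp a :&: supp b|%:R == 0 :> 'F_2 by rewrite raddf0.
have := card_suppD a b; rewrite F2_natr_eq0.
have /andP[/dvdnP[m ->] _] := Cwt _ (CD a b Ca Cb).
have /andP[/dvdnP[m1 ->] _] := Cwt _ Ca; have /andP[/dvdnP[m2 ->] _] := Cwt _ Cb.
lia.
Qed.

(** The matrix [A] listing the words of [C] has [C] as its row space, which is its own orthogonal
    complement in dimension 24; hence its rank is 12. *)
Lemma card_self_dual C : doubly_even_self_dual C -> #|C| = (2 ^ 12)%N.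
Proof.
move=> sdC; have [CD _ Cdual] := sdC.
have C0 : 0 \in C by apply: Cdual => b _; rewrite mul0mx.
pose A : 'M['F_2]_(#|C|, 24) := \matrix_(i < #|C|) enum_val i.
have CA a : (a \in C) = (a <= A)%MS.
  apply/idP/idP => [Ca|/submxP[q ->]].
    by rewrite -(enum_rankK_in Ca Ca) -(rowK (fun i => enum_val i)) row_sub.
  rewrite mulmx_sum_row; apply: (big_ind (fun v => v \in C)) => // i _.
  rewrite rowK [q 0 i]F2_nat; case: (_ == _); rewrite ?scale0r ?scale1r //.
  exact: enum_valP.
have sA_ker : (A <= kermx A^T)%MS.
  apply/sub_kermxP/matrixP => i j.
  have := doubly_even_orthogonal sdC (enum_valP i) (enum_valP j).
  move/matrixP/(_ 0 0); rewrite !mxE => e; rewrite -[RHS]e.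
  by apply: eq_bigr => l _; rewrite !mxE.
have sker_A : (kermx A^T <= A)%MS.
  apply/rV_subP => v /sub_kermxP vA; rewrite -CA; apply: Cdual => b.
  by rewrite CA => /submxP[q ->]; rewrite trmx_mul mulmxA vA mul0mx.
have rkA : \rank A = 12.
  have := mxrankS sA_ker; have := mxrankS sker_A.
  by rewrite mxrank_ker mxrank_tr; have := rank_leq_col A; lia.
have := card_rowg A; rewrite rkA card_Fp // => <-.
by apply: eq_card => a; rewrite mem_rowg CA.
Qed.

Lemma supp_inj : injective supp.
Proof.
move=> a b eq_ab; apply/rowP => i; rewrite [a 0 i]F2_nat [b 0 i]F2_nat.
by have /setP/(_ i) := eq_ab; rewrite !inE => ->.
Qed.

Lemma supp_surj (A : {set 'I_24}) : exists a, supp a = A.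
Proof.
exists (\row_i (i \in A)%:R); apply/setP => i.
by rewrite inE mxE F2_nat_eq0 negbK.
Qed.

Lemma card_weight k : #|[set a | #|supp a| == k]| = 'C(24, k).
Proof.
rewrite -[in RHS](card_ord 24) -card_draws -(card_imset _ supp_inj).
apply: eq_card => A; have [a <-] := supp_surj A.
by rewrite mem_imset ?inE //; apply: supp_inj.
Qed.

Lemma supp_eq0 a : (#|supp a| == 0%N) = (a == 0).
Proof.
rewrite cards_eq0 -(inj_eq supp_inj) (_ : supp 0 = set0) //.
by apply/setP => i; rewrite !inE mxE eqxx.
Qed.

Lemma odd_card_suppD (a b : 'rV['F_2]_24) :
  odd #|supp (a + b)| = odd #|supp a| (+) odd #|supp b|.
Proof. by rewrite -oddD -card_suppD oddD mul2n odd_double addbF. Qed.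

(** Translation by a word of weight 1 exchanges odd and even weights, so each class is half of the
    space. *)
Lemma card_odd : #|[set a | odd #|supp a|]| = (2 ^ 23)%N.
Proof.
have [e supp_e] := supp_surj [set ord0].
have e1 : #|supp e| = 1%N by rewrite supp_e cards1.
set O := [set _ | _]; have cardO : #|O| = #|~: O|.
  rewrite -(card_imset _ (@addrI _ e)); apply: eq_card => a.
  rewrite !inE; apply/imsetP/idP => [[b]|odd_a].
    by rewrite inE => odd_b ->; rewrite odd_card_suppD e1 odd_b.
  exists (a - e); last by rewrite addrC subrK.
  have := odd_card_suppD e (a - e); rewrite addrC subrK e1 !inE => odd_ae.
  by move: odd_a; rewrite odd_ae /= negbK.
apply: double_inj; rewrite -addnn {2}cardO cardsC card_mx -mul2n -expnS mul1n.
by congr (_ ^ _)%N; apply: card_Fp.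
Qed.

(* The spheres of radii 1 and 3 around the codewords are disjoint, and by
   counting they exhaust the vectors of odd weight; so a vector of weight 5 is
   at distance 3 from a codeword, which then has weight 8. *)
Lemma self_dual_octad_code C : doubly_even_self_dual C -> octad_code C.
Proof.
move=> sdC; have [CD Cwt Cdual] := sdC.
have C0 : 0 \in C by apply: Cdual => b _; rewrite mul0mx.
split=> // F F5; have [f supp_f] := supp_surj F.
pose E := [set a | #|supp a| == 1%N] :|: [set a | #|supp a| == 3%N].
have EP b : (b \in E) = (#|supp b| == 1%N) || (#|supp b| == 3%N) by rewrite !inE.
(* 24 + 2024 = 2048; with 2^12 codewords this gives the 2^23 vectors of odd weight. *)
have cardE : #|E| = (2 ^ 11)%N.
  rewrite cardsU !card_weight (_ : _ :&: _ = set0) ?cards0 //.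
  by apply/setP => a; rewrite !inE; case: eqP => // ->.
have oppv (a : 'rV['F_2]_24) : - a = a.
  apply/rowP => i; rewrite mxE [a 0 i]F2_nat.
  by case: (_ == _); rewrite ?oppr0 //; apply: val_inj.
have addvv (a : 'rV['F_2]_24) : a + a = 0 by rewrite -{2}[a]oppv subrr.
have Cw a : a \in C -> (#|supp a| <= 7)%N -> a = 0.
  move=> Ca; have /andP[/dvdnP[m em] n4] := Cwt a Ca => le7.
  by apply/eqP; rewrite -supp_eq0; lia.
pose add (p : 'rV['F_2]_24 * 'rV['F_2]_24) := p.1 + p.2.
(* If two sums agree, the codewords differ by a sum of two error words, of weight at most 6, and a
   codeword of weight below 8 is zero. *)
have add_inj : {in setX C E &, injective add}.
  move=> [a1 b1] [a2 b2]; rewrite !in_setX !EP /= => /andP[Ca1 Eb1] /andP[Ca2 Eb2] eq_add.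
  have eab : a1 + a2 = b1 + b2.
    have -> : a1 = a2 + b2 - b1 by rewrite -[a2 + b2]eq_add addrK.
    by rewrite oppv addrC !addrA addvv add0r addrC.
  have e0 : a1 + a2 = 0.
    apply: Cw; first exact: CD.
    rewrite eab; apply: leq_trans (_ : #|supp b1| + #|supp b2| <= 7)%N.
      by rewrite -card_suppD leq_addr.
    by case/orP: Eb1 => /eqP->; case/orP: Eb2 => /eqP->.
  have e12 : a1 = a2 by rewrite -[a1](addrK a2) e0 sub0r oppv.
  by congr (_, _); first exact: e12; apply: (@addrI _ a1); rewrite {2}e12.
have /setP/(_ f) : add @: setX C E = [set a | odd #|supp a|].
  apply/eqP; rewrite eqEcard card_odd card_in_imset // cardsX (card_self_dual sdC) cardE.
  rewrite -expnD leqnn andbT; apply/subsetP => _ /imsetP[[a b] + ->].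
  rewrite in_setX EP /= => /andP[/Cwt/andP[/dvdnP[m em] _] Eb].
  rewrite inE odd_card_suppD em oddM andbF.
  by case/orP: Eb => /eqP->.
rewrite inE supp_f F5 => /imsetP[[c e]]; rewrite in_setX EP /= => /andP[Cc Ee] def_f.
have fc : e = f + c by rewrite def_f /add /= addrAC -{2}[c]oppv subrr add0r.
have := card_suppD f c; rewrite -fc supp_f F5 => cardD.
have /andP[/dvdnP[m em] n4] := Cwt c Cc.
have := subset_leq_card (subsetIl F (supp c)); rewrite F5 => le_I.
have le_Ic := subset_leq_card (subsetIr F (supp c)).
(* With w the weight of [c] and i the overlap, w + 5 - 2i is 1 or 3 and i is at most 5, so w is at
   most 8. As w is a multiple of 4 other than 4, and w = 0 would force i = 0, only w = 8 and i = 5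
   remain. *)
have [c8 I5] : #|supp c| = 8%N /\ #|F :&: supp c| = 5%N.
  move: cardD Ee em n4 le_I le_Ic; move: #|_ :&: _| #|supp c| #|supp e| => i w l; lia.
exists c; split=> //; have /eqP/setIidPl : F :&: supp c == F; last by [].
by rewrite eqEcard subsetIl F5 I5.
Qed.

(** * A generator matrix of the extended cyclic code, and uniqueness *)

Definition cyclic_part (a : 'rV['F_2]_24) : {poly 'F_2} :=
  \poly_(i < 23) a 0 (inord i).

Lemma cyclic_partD a b : cyclic_part (a + b) = cyclic_part a + cyclic_part b.
Proof.
apply/polyP => i; rewrite coefD !coef_poly.
by case: ifP; rewrite ?mxE ?addr0.
Qed.

Lemma cyclic_partZ t a : cyclic_part (t *: a) = t *: cyclic_part a.
Proof.
apply/polyP => i; rewrite coefZ !coef_poly.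
by case: ifP; rewrite ?mxE ?mulr0.
Qed.

Lemma cyclic_part0 : cyclic_part 0 = 0.
Proof. by rewrite -(scale0r 0) cyclic_partZ scale0r. Qed.

Lemma golay_closed : golay 0 /\ (forall a b, golay a -> golay b -> golay (a + b)).
Proof.
rewrite /golay; split=> [|a b].
  rewrite -/(cyclic_part _) cyclic_part0 dvdp0 big1 ?eqxx // => i _.
  by rewrite mxE.
rewrite -/(cyclic_part _) -/(cyclic_part _) -/(cyclic_part _).
move=> /andP[pa /eqP sa] /andP[pb /eqP sb]; rewrite cyclic_partD dvdp_add //=.
by under eq_bigr do rewrite mxE; rewrite big_split /= sa sb addr0.
Qed.

Lemma golay_genE : golay_gen = \poly_(d < 12) (d \in [:: 0; 2; 4; 5; 6; 10; 11]%N)%:R.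
Proof.
apply/polyP => i; rewrite coef_poly !coefD !coefXn coef1.
by do 12![case: i => [|i]; first exact: val_inj]; exact: val_inj.
Qed.

Lemma cyclic_part_row k : (k < 12)%N ->
  cyclic_part (bitvec (golay_row k)) = 'X^k * golay_gen.
Proof.
move=> lt_k; apply/polyP => i; rewrite coefXnM golay_genE !coef_poly.
have [lt_i|le_i] := ltnP i 23; last first.
  by case: ltnP => // _; rewrite (_ : (i - k < 12)%N = false) //; lia.
rewrite mxE nth_mkseq inordK; do ?lia.
rewrite [in X in _ || X]ltn_eqF // orbF; have [lt_ik|le_ki] := ltnP i k.
  by rewrite (_ : (_ \in _) = false) //; apply/mapP => -[d _ def_i]; lia.
have [lt_ik|le_ik] := ltnP (i - k) 12.
  by rewrite -{1}(subnKC le_ki) mem_map //; apply: addnI.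
rewrite (_ : (_ \in _) = false) //; apply/mapP => -[d + def_i].
rewrite !inE; lia.
Qed.

Lemma golay_golay_row k : (k < 12)%N -> golay (bitvec (golay_row k)).
Proof.
move=> lt_k; rewrite /golay -/(cyclic_part _) cyclic_part_row // dvdp_mulIr /=.
have -> : \sum_i bitvec (golay_row k) 0 i = #|supp (bitvec (golay_row k))|%:R.
  rewrite -sum1_card natr_sum [RHS]big_mkcond; apply: eq_bigr => i _.
  by rewrite inE [bitvec _ _ _]F2_nat F2_nat_eq0 negbK; case: (_ == _).
rewrite F2_natr_eq0 card_supp_bitvec ?size_mkseq //.
by move: k lt_k; do 12![case=> //].
Qed.

Definition golay_mx : 'M['F_2]_(12, 24) := \matrix_(i < 12) bitvec (golay_row i).

Lemma cyclic_part_mul q : cyclic_part (q *m golay_mx) = rVpoly q * golay_gen.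
Proof.
rewrite mulmx_sum_row (big_morph _ cyclic_partD cyclic_part0).
rewrite /rVpoly poly_def mulr_suml; apply: eq_bigr => j _.
by rewrite cyclic_partZ rowK cyclic_part_row // valK -scalerAl.
Qed.

(** A relation among the rows is a polynomial whose product with the nonzero [golay_gen]
    vanishes. *)
Lemma golay_mx_free : row_free golay_mx.
Proof.
rewrite -kermx_eq0; apply/eqP/row_matrixP => i; rewrite row0.
have /sub_kermxP : (row i (kermx golay_mx) <= kermx golay_mx)%MS by apply: row_sub.
move: (row i _) => q qG.
suff q0 : rVpoly q = 0 by rewrite -[q]rVpolyK q0 linear0.
have /eqP := cyclic_part_mul q; rewrite qG cyclic_part0 eq_sym mulf_eq0 => /orP[/eqP //|].
rewrite golay_genE => /eqP/polyP/(_ 0%N); rewrite coef_poly coef0 //.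
Qed.

Lemma golay_mx_self_orthogonal : golay_mx *m golay_mx^T = 0.
Proof.
apply/matrixP => i j; have -> : (golay_mx *m golay_mx^T) i j =
   (bitvec (golay_row i) *m (bitvec (golay_row j))^T) 0 0.
  by rewrite !mxE; apply: eq_bigr => l _; rewrite !mxE.
rewrite mulmx_trE !mxE eqxx mulr1n; apply/eqP; rewrite F2_natr_eq0.
have : all (fun i => all (fun j =>
    ~~ odd (count id [seq p.1 && p.2 | p <- zip (golay_row i) (golay_row j)]))
    (iota 0 12)) (iota 0 12).
  by vm_compute.
move=> /allP/(_ i); rewrite mem_iota => /(_ (ltn_ord i))/allP/(_ j).
rewrite mem_iota => /(_ (ltn_ord j)).
rewrite -card_supp_bitvec ?size_map ?size_zip ?size_map ?size_iota //.
congr (~~ odd _); apply: eq_card => l; rewrite !inE !mxE !F2_nat_eq0 !negbK.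
by rewrite (nth_map (false, false)) ?size_zip ?size_map ?size_iota // nth_zip ?size_map.
Qed.

(** The row space is self-orthogonal of rank 12 in dimension 24, so it equals its orthogonal
    complement. *)
Lemma golay_mx_dual (a : 'rV['F_2]_24) :
  (forall i, (i < 12)%N -> a *m (bitvec (golay_row i))^T = 0) ->
  (a <= golay_mx)%MS.
Proof.
move=> orth_a.
have sub : (golay_mx <= kermx golay_mx^T)%MS.
  by apply/sub_kermxP/golay_mx_self_orthogonal.
have /eqmxP/eqmx_sym eqG : (golay_mx == kermx golay_mx^T)%MS.
  rewrite -(geq_leqif (mxrank_leqif_eq sub)) mxrank_ker mxrank_tr.
  by rewrite (eqP golay_mx_free).
rewrite -eqG; apply/sub_kermxP/matrixP => i j.
have := orth_a j (ltn_ord j) => /matrixP/(_ 0 0); rewrite !mxE ord1 => e; rewrite -[RHS]e.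
by apply: eq_bigr => l _; rewrite !mxE.
Qed.

Lemma submx_golay (a : 'rV['F_2]_24) (C : {set 'rV['F_2]_24}) :
  0 \in C -> {in C &, forall a b, a + b \in C} ->
  (forall i, (i < 12)%N -> bitvec (golay_row i) \in C) ->
  (a <= golay_mx)%MS -> a \in C.
Proof.
move=> C0 CD Crow /submxP[q ->]; rewrite mulmx_sum_row.
apply: (big_ind (fun v => v \in C)) => // i _.
rewrite rowK [q 0 i]F2_nat; case: (_ == _); rewrite ?scale0r ?scale1r //.
exact: Crow.
Qed.

Lemma golay_mx_sub a : (a <= golay_mx)%MS -> golay a.
Proof.
have [g0 gD] := golay_closed.
have := @submx_golay a [set v | golay v]; rewrite !inE; apply=> //.
- by move=> u v; rewrite !inE; apply: gD.
- by move=> i lt_i; rewrite inE golay_golay_row.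
Qed.

(** Dividing the cyclic part by the generator leaves a polynomial with at most 12 coefficients,
    which serve as coefficients of the rows. This settles the first 23 coordinates, and parity
    settles the last. *)
Lemma golay_sub a : golay a -> (a <= golay_mx)%MS.
Proof.
move=> golay_a; have /andP[] := golay_a; rewrite -/(cyclic_part a) => /dvdpP[h def_h] _.
have sz_gen : size golay_gen = 12 by rewrite golay_genE size_poly_eq.
have sz_h : (size h <= 12)%N.
  have [->|nz_h] := eqVneq h 0; first by rewrite size_poly0.
  have : (size (cyclic_part a) <= 23)%N by apply: size_poly.
  rewrite def_h size_mul ?sz_gen // ?addnS /=; first by rewrite addnC !ltnS.
  by rewrite -size_poly_eq0 sz_gen.
pose b := poly_rV h *m golay_mx.
have golay_b : golay b by apply/golay_mx_sub/submxMl.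
suff -> : a = b by apply: submxMl.
have eq_cyc (i : 'I_24) : (i < 23)%N -> a 0 i = b 0 i.
  move=> lt_i; have : cyclic_part a = cyclic_part b.
    by rewrite cyclic_part_mul poly_rV_K // def_h.
  by move/polyP/(_ i); rewrite !coef_poly lt_i inord_val.
have : \sum_i a 0 i = \sum_i b 0 i.
  by have /andP[_ /eqP->] := golay_a; have /andP[_ /eqP->] := golay_b.
have sumE (v : 'rV['F_2]_24) :
  \sum_i v 0 i = \sum_(i < 23) v 0 (widen_ord (leqnSn 23) i) + v 0 ord_max.
  by rewrite big_ord_recr.
rewrite !sumE; rewrite (eq_bigr (fun i : 'I_23 => b 0 (widen_ord (leqnSn 23) i))); last first.
  by move=> i _; apply: eq_cyc => /=.
move/addrI => eq_last; apply/rowP => i.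
have [/eq_cyc //|le_i] := ltnP i 23.
suff -> : i = ord_max by [].
by apply/val_inj/eqP; rewrite eqn_leq le_i -ltnS ltn_ord.
Qed.

(** The permuted code contains the twelve rows, hence all Golay words. Conversely its words are
    orthogonal to the rows, and the span of the rows is self-dual. *)
Lemma golay_unique C : doubly_even_self_dual C ->
  exists s : 'S_24, forall a, golay a = (col_perm s a \in C).
Proof.
move=> sdC; have ocC := self_dual_octad_code sdC; have [s Cs] := octad_code_rows ocC.
have [D0 DD _ _] := octad_code_perm s ocC.
exists s => a; apply/idP/idP => [/golay_sub|Ca].
  have := @submx_golay a _ D0 DD; rewrite [a \in _]inE; apply=> i lt_i; rewrite inE; exact: Cs.
apply: golay_mx_sub; apply: golay_mx_dual => i /Cs/(doubly_even_orthogonal sdC Ca).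
by rewrite tr_col_perm mul_row_perm -col_permM mulVg col_perm1.
Qed.

(** Every row has weight 8, so the all-ones word is orthogonal to all rows. *)
Lemma golay_ones : golay (const_mx 1).
Proof.
apply/golay_mx_sub/golay_mx_dual => i lt_i; rewrite mulmx_trE.
have -> : supp (const_mx 1) = setT by apply/setP => j; rewrite !inE mxE.
rewrite setTI card_supp_bitvec ?size_mkseq // (_ : count _ _ = 8%N); last first.
  by move: i lt_i; do 12![case=> //].
by rewrite (_ : 8%:R = 0) ?raddf0 //; apply/eqP; rewrite F2_natr_eq0.
Qed.

From mathcomp Require Import all_classical all_reals.

Local Open Scope classical_set_scope.
Local Open Scope card_scope.
Local Open Scope ring_scope.

(** * Lattices with a frame of roots *)

Section Dot.
Variables (R : realType) (n : nat).
Implicit Types (a b : 'rV[R]_n) (t : R).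

Lemma dotC a b : dot a b = dot b a.
Proof. by rewrite /dot -[in RHS](trmxK b) -trmx_mul [RHS]mxE. Qed.

Lemma dotDl a1 a2 b : dot (a1 + a2) b = dot a1 b + dot a2 b.
Proof. by rewrite /dot mulmxDl mxE. Qed.

Lemma dotZl t a b : dot (t *: a) b = t * dot a b.
Proof. by rewrite /dot -scalemxAl mxE. Qed.

Lemma dotNl a b : dot (- a) b = - dot a b.
Proof. by rewrite -scaleN1r dotZl mulN1r. Qed.

Lemma dotDr a b1 b2 : dot a (b1 + b2) = dot a b1 + dot a b2.
Proof. by rewrite dotC dotDl !(dotC a). Qed.

Lemma dotZr t a b : dot a (t *: b) = t * dot a b.
Proof. by rewrite dotC dotZl (dotC a). Qed.

Lemma dotNr a b : dot a (- b) = - dot a b.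
Proof. by rewrite dotC dotNl (dotC a). Qed.

Lemma dot0l b : dot 0 b = 0.
Proof. by rewrite -(scale0r 0) dotZl mul0r. Qed.

Lemma dot0r b : dot b 0 = 0.
Proof. by rewrite dotC dot0l. Qed.

Lemma dot_suml (I : finType) (P : pred I) (F : I -> 'rV[R]_n) b :
  dot (\sum_(i | P i) F i) b = \sum_(i | P i) dot (F i) b.
Proof. by rewrite (big_morph (fun a => dot a b) (fun a1 a2 => dotDl a1 a2 b) (dot0l b)). Qed.

Lemma sqnorm_eq0 a : (sqnorm a == 0) = (a == 0).
Proof.
apply/idP/eqP => [|->]; last by rewrite /sqnorm dot0l.
rewrite /sqnorm /dot mxE psumr_eq0 => [/allP a0|i _]; last first.
  by rewrite mxE -expr2 sqr_ge0.
apply/rowP => i; have := a0 i (mem_index_enum _).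
by rewrite !mxE mulf_eq0 orbb => /eqP.
Qed.

End Dot.

Definition dotE := (dotDl, dotDr, dotNl, dotNr, dotZl, dotZr, dot0l, dot0r).

Section Frame.
Variables (R : realType) (n : nat) (r : 'I_24 -> 'rV[R]_n).
Hypothesis dot_r : forall i j, dot (r i) (r j) = if i == j then 2 else 0.

Definition half_sum (b : 'rV[int]_24) : 'rV[R]_n :=
  2^-1 *: \sum_i (b 0 i)%:~R *: r i.

Lemma half_sumD b1 b2 : half_sum (b1 + b2) = half_sum b1 + half_sum b2.
Proof.
rewrite /half_sum -scalerDr -big_split; congr (_ *: _).
by apply: eq_bigr => i _; rewrite mxE intrD scalerDl.
Qed.

Lemma half_sum2 b : half_sum (b *+ 2) = \sum_i (b 0 i)%:~R *: r i.
Proof.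
rewrite /half_sum scaler_sumr; apply: eq_bigr => i _.
by rewrite scalerA mulmxnE rmorphMn /= -[_%:~R *+ 2]mulr_natl mulKf ?pnatr_eq0.
Qed.

Lemma dot_half_sum b i : dot (half_sum b) (r i) = (b 0 i)%:~R.
Proof.
rewrite dotZl dot_suml (bigD1 i) //= dotZl dot_r eqxx big1 => [|j ji].
  by rewrite addr0 mulrC mulfK // pnatr_eq0.
by rewrite dotZl dot_r (negPf ji) mulr0.
Qed.

Lemma dot_half_sums b1 b2 :
  dot (half_sum b1) (half_sum b2) = 2^-1 * (\sum_i b1 0 i * b2 0 i)%:~R.
Proof.
rewrite [dot _ _]dotC {1}/half_sum dotZl dot_suml rmorph_sum; congr (_ * _).
by apply: eq_bigr => i _ /=; rewrite dotZl dotC dot_half_sum intrM mulrC.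
Qed.

Lemma F2_intr_eq0 (k : int) : (k%:~R == 0 :> 'F_2) = (2 %| k)%Z.
Proof. by rewrite (dvdz_pcharf (pchar_Fp (isT : prime 2))). Qed.

Definition lift01 (a : 'rV['F_2]_24) : 'rV[int]_24 := \row_i (a 0 i != 0)%:Z.

Lemma lift01K a : map_mx intr (lift01 a) = a.
Proof. by apply/rowP => i; rewrite !mxE [RHS]F2_nat; case: (_ == _). Qed.

Lemma map_intr_eqP (b1 b2 : 'rV[int]_24) :
  map_mx intr b1 = map_mx intr b2 :> 'rV['F_2]_24 -> exists d, b2 = b1 + d *+ 2.
Proof.
move=> eq_b; exists (\row_i divz (b2 0 i - b1 0 i) 2); apply/rowP => i.
have eq_i : (b1 0 i)%:~R = (b2 0 i)%:~R :> 'F_2.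
  by have /rowP/(_ i) := eq_b; rewrite !mxE.
have dvd2 : (2 %| (b2 0 i - b1 0 i)%R)%Z.
  by rewrite -F2_intr_eq0 intrB eq_i subrr.
by rewrite [RHS]mxE mulmxnE mxE -[divz _ _ *+ 2]mulr_natr divzK // addrC subrK.
Qed.

Variable G : set 'rV[R]_n.
Hypotheses (GD : forall a b, G a -> G b -> G (a + b)) (GN : forall a, G a -> G (- a)).
Hypotheses (Gr : forall i, G (r i)) (G_int : integral_lattice G).

Lemma G_sum (I : finType) (F : I -> 'rV[R]_n) :
  I -> (forall i, G (F i)) -> G (\sum_i F i).
Proof.
move=> i0 GF; apply: (big_ind G) => //.
by rewrite -(subrr (F i0)); apply/GD/GN.
Qed.

Lemma G_scale (k : int) a : G a -> G (k%:~R *: a).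
Proof.
move=> Ga; suff Gnat m : G (m%:R *: a).
  case: k => m; first exact: Gnat.
  by rewrite NegzE intrN scaleNr; apply/GN/Gnat.
elim: m => [|m IH]; first by rewrite scale0r -(subrr a); apply/GD/GN.
by rewrite -natr1 scalerDl scale1r; apply: GD.
Qed.

(** Changing coefficients by even integers adds an integral combination of the frame, which lies in
    [G]. *)
Lemma half_sum_parity (b1 b2 : 'rV[int]_24) :
  map_mx intr b1 = map_mx intr b2 :> 'rV['F_2]_24 -> G (half_sum b1) -> G (half_sum b2).
Proof.
move=> /map_intr_eqP[d ->] Gb1; rewrite half_sumD half_sum2; apply: GD => //.
by apply: G_sum => [|i]; [exact: ord0 | exact/G_scale].
Qed.

(** The glue code of [G] over the lattice spanned by the frame, read off on coefficients 0 and 1. *)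
Definition frame_code : {set 'rV['F_2]_24} :=
  finset (fun a => `[< G (half_sum (lift01 a)) >]).

Lemma frame_codeP b : (map_mx intr b \in frame_code) <-> G (half_sum b).
Proof.
by rewrite inE; split=> [/asboolP|Gb]; last apply/asboolP; apply: half_sum_parity;
  rewrite ?lift01K.
Qed.

Hypothesis G_even : even_lattice G.
Hypothesis G_span : forall a, G a -> a = \sum_i (dot a (r i) / 2) *: r i.
Hypothesis G_roots : forall a, G a -> sqnorm a = 2 -> exists i, a = r i \/ a = - r i.
Hypothesis G_dual : forall a, a = \sum_i (dot a (r i) / 2) *: r i ->
  (forall b, G b -> dot a b \is a Num.int) -> G a.

Lemma half_sumE a : (forall i, dot a (r i) \is a Num.int) ->
  a = \sum_i (dot a (r i) / 2) *: r i -> exists b, a = half_sum b.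
Proof.
move=> int_a def_a; exists (\row_i Num.floor (dot a (r i))).
rewrite {1}def_a /half_sum scaler_sumr; apply: eq_bigr => i _.
by rewrite mxE scalerA mulrC floorK.
Qed.

Lemma half_sum_span b : half_sum b = \sum_i (dot (half_sum b) (r i) / 2) *: r i.
Proof.
rewrite [LHS]scaler_sumr; apply: eq_bigr => i _.
by rewrite scalerA mulrC dot_half_sum.
Qed.

Lemma sqnorm_half_sum01 a : sqnorm (half_sum (lift01 a)) = 2^-1 * #|supp a|%:R.
Proof.
rewrite /sqnorm dot_half_sums; congr (_ * _).
rewrite -sum1_card natr_sum [RHS]big_mkcond rmorph_sum; apply: eq_bigr => i _.
by rewrite !mxE inE; case: (_ != _).
Qed.

(** A half sum with coefficients 0 and 1 has norm half its weight, so evenness of [G] makes weights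
    divisible by 4. Two half sums have integral inner product exactly when their words are
    orthogonal modulo 2, so self-duality of [G] passes to the code. *)
Lemma frame_code_self_dual : doubly_even_self_dual frame_code.
Proof.
split.
- move=> a b; rewrite -{1}(lift01K a) -{1}(lift01K b) => /frame_codeP Ga /frame_codeP Gb.
  rewrite -(lift01K a) -(lift01K b) -map_mxD; apply/frame_codeP.
  by rewrite half_sumD; apply: GD.
- move=> a; rewrite inE => /asboolP Ga; apply/andP; split.
    have [k] := G_even Ga; rewrite sqnorm_half_sum01 => e.
    have : #|supp a|%:R = (4 * k)%:~R :> R by rewrite intrM; lra.
    rewrite -[LHS]/((Posz _)%:~R) => /intr_inj e'.
    by apply/dvdnP; exists `|k|%N; lia.
  (* Weight 4 would give a root, hence some [r i] or its opposite. Its inner product with [r i]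
     would be 2 or -2, yet it is a coefficient 0 or 1. *)
  apply/eqP => a4; have [] := G_roots Ga; first by rewrite sqnorm_half_sum01 a4; lra.
  move=> i [] e; have := dot_half_sum (lift01 a) i; rewrite e ?dotNl dot_r eqxx mxE.
    by case: (_ != _) => /eqP; rewrite -?[_%:~R]/(_%:R) ?eqr_nat ?pnatr_eq0.
  move=> /eqP; rewrite eq_sym -addr_eq0 -natrD pnatr_eq0; lia.
move=> a orth_a; rewrite inE; apply/asboolP/G_dual; first exact: half_sum_span.
move=> g Gg; have [|b def_g] := half_sumE _ (G_span Gg).
  by move=> i; apply: G_int.
have /orth_a : map_mx intr b \in frame_code by apply/frame_codeP; rewrite -def_g.
move=> /matrixP/(_ 0 0); rewrite -{1}(lift01K a) map_trmx -map_mxM !mxE => /eqP.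
under eq_bigr do rewrite [b^T _ _]mxE.
rewrite F2_intr_eq0 => /dvdzP[m e]; rewrite def_g dot_half_sums e.
by apply/intrP; exists m; rewrite intrM mulrC mulfK ?pnatr_eq0.
Qed.

Lemma niemeier_of_frame : exists s : 'S_24, niemeier_A1_24 (r \o s) G.
Proof.
have [s golayE] := golay_unique frame_code_self_dual; exists (s^-1)%g; split.
  by move=> i j; rewrite dot_r (inj_eq perm_inj).
have half_sumE' (a : 'rV[int]_24) : 2^-1 *: \sum_i (a 0 i)%:~R *: (r \o (s^-1)%g) i =
    half_sum (col_perm s a).
  rewrite /half_sum (reindex_inj (@perm_inj _ s)); congr (_ *: _).
  by apply: eq_bigr => i _; rewrite /= permK mxE.
apply/seteqP; split=> [a Ga|_ [a [golay_a ->]]].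
  have [i|b def_a] := half_sumE _ (G_span Ga); first exact: G_int.
  exists (col_perm s^-1 b); rewrite half_sumE' -col_permM mulgV col_perm1; split=> //.
  rewrite golayE map_col_perm -col_permM mulgV col_perm1.
  by apply/frame_codeP; rewrite -def_a.
by rewrite half_sumE'; apply/frame_codeP; rewrite map_col_perm -golayE.
Qed.

End Frame.

(** * Integral and real spans, and orthogonal expansions *)

Section Spans.
Variables (R : realType) (n : nat).
Implicit Types (A P : set 'rV[R]_n) (a b : 'rV[R]_n).

Lemma Zspan_min A P : P 0 -> (forall a b, P a -> P b -> P (a + b)) ->
  (forall (k : int) a, A a -> P (k%:~R *: a)) -> Zspan A `<=` P.
Proof. by move=> P0 PD PZ _ [k [m [t [At ->]]]]; apply: big_ind => // i _; apply: PZ. Qed.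

Lemma Rspan_min A P : P 0 -> (forall a b, P a -> P b -> P (a + b)) ->
  (forall t a, A a -> P (t *: a)) -> Rspan A `<=` P.
Proof. by move=> P0 PD PZ _ [k [m [t [At ->]]]]; apply: big_ind => // i _; apply: PZ. Qed.

Lemma Rspan_gen A a : A a -> Rspan A a.
Proof.
by move=> Aa; exists 1%N, (fun=> 1), (fun=> a); rewrite big_ord1 scale1r; split.
Qed.

Lemma Zspan_pt (f : 'I_3 -> 'rV[R]_n) a :
  Zspan [set f 0; f 1; f 2%:R] a <-> exists m : 'I_3 -> int, a = \sum_i (m i)%:~R *: f i.
Proof.
split; last first.
  case=> m ->; exists 3%N, m, f; split=> // i.
  by case: i => [[|[|[|i]]] //= lt_i]; [left; left|left; right|right]; congr f; apply: val_inj.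
move: a; apply: Zspan_min.
- by exists (fun=> 0); rewrite big1 // => i _; rewrite scale0r.
- move=> _ _ [m1 ->] [m2 ->]; exists (fun i => m1 i + m2 i).
  by rewrite -big_split; apply: eq_bigr => i _; rewrite intrD scalerDl.
move=> k a fa; suff [i ->] : exists i, a = f i.
  exists (fun j => if j == i then k else 0); rewrite (bigD1 i) //= eqxx big1 ?addr0 // => j.
  by move/negPf->; rewrite scale0r.
by case: fa => [[->|->]|->]; [exists 0|exists 1|exists 2%:R].
Qed.

Lemma lattice_basisP (m : nat) (L : set 'rV[R]_n) (B : 'M[R]_(m, n)) a :
  lattice_basis L B -> L a <-> exists k : 'rV[int]_m, a = map_mx intr k *m B.
Proof.
case=> _ ->; split.
  move: a; apply: Zspan_min.
  - by exists 0; rewrite map_mx0 mul0mx.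
  - by move=> _ _ [k1 ->] [k2 ->]; exists (k1 + k2); rewrite map_mxD mulmxDl.
  move=> k _ [i _ <-]; exists (k *: delta_mx 0 i).
  by rewrite map_mxZ map_delta_mx -scalemxAl -rowE.
case=> k ->; exists m, (fun i => k 0 i), (fun i => row i B); split.
  by move=> i; exists i.
by rewrite mulmx_sum_row; apply: eq_bigr => i _; rewrite mxE.
Qed.

Lemma Rspan_basisP (m : nat) (L : set 'rV[R]_n) (B : 'M[R]_(m, n)) a :
  lattice_basis L B -> Rspan L a <-> (a <= B)%MS.
Proof.
move=> L_basis; split.
  move: a; apply: Rspan_min.
  - exact: sub0mx.
  - by move=> a b; apply: addmx_sub.
  move=> t a /(lattice_basisP _ L_basis)[k ->].
  by apply/scalemx_sub/submxMl.
case/submxP=> q ->; exists m, (fun i => q 0 i), (fun i => row i B).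
split=> [i|]; last by rewrite mulmx_sum_row.
apply/(lattice_basisP _ L_basis); exists (delta_mx 0 i).
by rewrite map_delta_mx -rowE.
Qed.

(** Orthogonal vectors of nonzero norm are independent, so the rank bound makes the [m] of them span
    [V]. *)
Lemma orthogonal_expansion (m p : nat) (V : 'M[R]_(p, n)) (f : 'I_m -> 'rV[R]_n) a :
  (forall i j, i != j -> dot (f i) (f j) = 0) -> (forall i, sqnorm (f i) != 0) ->
  (forall i, (f i <= V)%MS) -> (\rank V <= m)%N -> (a <= V)%MS ->
  a = \sum_i (dot a (f i) / sqnorm (f i)) *: f i.
Proof.
move=> orth_f f_neq0 fV rkV aV; pose F := \matrix_(i < m) f i.
have dotF (q : 'rV_m) i : dot (q *m F) (f i) = q 0 i * sqnorm (f i).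
  rewrite mulmx_sum_row dot_suml (bigD1 i) //= dotZl rowK big1 ?addr0 // => j ji.
  by rewrite dotZl rowK orth_f // mulr0.
have freeF : row_free F.
  rewrite -kermx_eq0; apply/eqP/row_matrixP => i; rewrite row0.
  have /sub_kermxP : (row i (kermx F) <= kermx F)%MS by apply: row_sub.
  move: (row i _) => q qF; apply/rowP => j; apply/eqP; rewrite mxE.
  by have := dotF q j; rewrite qF dot0l => /esym/eqP; rewrite mulf_eq0 (negPf (f_neq0 j)) orbF.
have sFV : (F <= V)%MS by apply/row_subP => i; rewrite rowK.
have eqFV : (F == V)%MS.
  rewrite -(geq_leqif (mxrank_leqif_eq sFV)) (eqP freeF) //.
have /submxP[q def_a] : (a <= F)%MS by rewrite (eqmxP eqFV).
rewrite {1}def_a mulmx_sum_row; apply: eq_bigr => i _.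
by rewrite rowK def_a dotF mulfK.
Qed.

End Spans.

(** * The hexagon *)

Section Hexagon.
Variables (R : realType) (n : nat) (L Cp Cm : set 'rV[R]_n) (B : 'M[R]_(26, n)).
Variables (c x y z : 'rV[R]_n).
Hypotheses (L_basis : lattice_basis L B) (L_integral : integral_lattice L).
Hypotheses (L_even : even_lattice L) (L_min : lattice_min L 4).
Hypothesis L_disc : quot (dual_lattice L) L = [set L; Cp; Cm].
Hypothesis Cm_opp : Cm = [set - a | a in Cp].
Hypotheses (c_norm : sqnorm c = 3) (c_orth : forall a, Rspan L a -> dot a c = 0).
Local Notation X := (hex_points Cp).
Hypothesis X_hex : generalized_hexagon X (hex_lines X) 2 8.
Hypothesis xyz_line : line_triple X x y z.

Implicit Types (a b d p q : 'rV[R]_n).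

Lemma LD a b : L a -> L b -> L (a + b).
Proof.
move=> /(lattice_basisP _ L_basis)[k ->] /(lattice_basisP _ L_basis)[l ->].
by apply/(lattice_basisP _ L_basis); exists (k + l); rewrite map_mxD mulmxDl.
Qed.

Lemma LZ (k : int) a : L a -> L (k%:~R *: a).
Proof.
move=> /(lattice_basisP _ L_basis)[l ->]; apply/(lattice_basisP _ L_basis).
by exists (k *: l); rewrite map_mxZ scalemxAl.
Qed.

Lemma LN a : L a -> L (- a).
Proof. by move=> /(LZ (-1)); rewrite rmorphN1 scaleN1r. Qed.

Lemma LB a b : L a -> L b -> L (a - b).
Proof. by move=> La /LN; apply: LD. Qed.

Lemma L0 : L 0.
Proof. by have [[a [La _ _]] _] := L_min; rewrite -(subrr a); apply: LB. Qed.

Lemma CpP a b : Cp a -> Cp b <-> L (b - a).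
Proof.
have : [set L; Cp; Cm] Cp by left; right.
rewrite -L_disc => -[e _ <-] [l Ll <-]; split=> [[l' Ll' <-]|Lb].
  by rewrite opprD addrACA subrr add0r; apply: LB.
by exists (l + (b - (e + l))); [apply: LD | rewrite addrA addrC subrK].
Qed.

Lemma Cp_dual a : Cp a -> dual_lattice L a.
Proof.
have : [set L; Cp; Cm] Cp by left; right.
rewrite -L_disc => -[e [/(Rspan_basisP _ L_basis) Re e_int] <-] [l Ll <-].
have /(Rspan_basisP _ L_basis) Rl := Rspan_gen Ll; split.
  by apply/(Rspan_basisP _ L_basis); apply: addmx_sub.
by move=> b Lb; rewrite dotDl rpredD ?e_int ?L_integral.
Qed.

Lemma dual_cases a : dual_lattice L a -> [\/ L a, Cp a | Cp (- a)].
Proof.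
move=> dual_a; have a_coset : Defs.coset L a a by exists 0; [exact: L0 | rewrite addr0].
have : quot (dual_lattice L) L (Defs.coset L a) by exists a.
rewrite L_disc => -[[eq_a|eq_a]|eq_a]; rewrite eq_a in a_coset.
- by constructor 1.
- by constructor 2.
by constructor 3; move: a_coset; rewrite Cm_opp => -[b Cb <-]; rewrite opprK.
Qed.

Lemma X_Rspan p : X p -> Rspan L p.
Proof. by case=> /Cp_dual[]. Qed.

Lemma X_xyz : [/\ X x, X y, X z & z = - x - y].
Proof.
case: xyz_line => Xx Xy Xz /eqP; rewrite addrC addr_eq0 => /eqP def_z.
by split=> //; rewrite def_z opprD.
Qed.

(** The difference is (p, q - p), where [q - p] lies in [L] and [p] in its dual. *)
Lemma X_dot_int p q : X p -> X q -> dot p q - 8 / 3 \is a Num.int.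
Proof.
move=> [Cp_p np] [Cp_q nq]; have Lqp := (CpP q Cp_p).1 Cp_q.
rewrite -np /sqnorm -dotNr -dotDr.
by apply: (Cp_dual Cp_p).2.
Qed.

Lemma sqnormB p q : sqnorm (p - q) = sqnorm p + sqnorm q - 2 * dot p q.
Proof. rewrite /sqnorm !dotE (dotC q p); lra. Qed.

(** The nonzero vector [p - q] of [L] has norm 16/3 - 2(p, q), which is at least 4; so (p, q) is at
    most 2/3, and it is 2/3 modulo integers. *)
Lemma X_dot_vals p q : X p -> X q -> p != q -> exists k : nat, dot p q = 2 / 3 - k%:R.
Proof.
move=> Xp Xq neq_pq; have /intrP[m em] := X_dot_int Xp Xq.
have Lpq : L (p - q) by apply/(CpP p Xq.1); case: Xp.
have := L_min.2 _ Lpq; rewrite subr_eq0 => /(_ neq_pq).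
rewrite sqnormB Xp.2 Xq.2 => ge4.
have : m%:~R <= (-2)%:~R :> R by rewrite rmorphN /=; lra.
rewrite ler_int => le_m; have [k def_m] : exists k : nat, m = - 2 - k%:Z.
  by exists (absz (- 2 - m)%R); lia.
exists k; have : dot p q - 8 / 3 = - 2 - k%:R by rewrite em def_m intrB rmorphN.
lra.
Qed.

Lemma X_dot_le p q : X p -> X q -> p != q -> dot p q <= 2 / 3.
Proof. by move=> Xp Xq /(X_dot_vals Xp Xq)[k ->]; have := ler0n R k; lra. Qed.

(** Modulo [L] all points agree, so [- p - q] is congruent to [- x - y], which is the point [z]. *)
Lemma X_third p q : X p -> X q -> dot p q = - 4 / 3 -> X (- p - q).
Proof.
move=> Xp Xq pq; have [Xx Xy Xz def_z] := X_xyz; split; last first.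
  rewrite sqnormB /sqnorm !dotE -!/(sqnorm _) Xp.2 Xq.2 pq; lra.
apply/(CpP _ Xz.1); rewrite def_z.
have -> : - p - q - (- x - y) = (x - p) + (y - q).
  by rewrite opprD !opprK addrC addrACA.
by apply: LD; [apply/(CpP x Xp.1); case: Xx | apply/(CpP y Xq.1); case: Xy].
Qed.

Lemma X_lineP p q : X p -> X q -> dot p q = - 4 / 3 -> line_triple X p q (- p - q).
Proof.
move=> Xp Xq pq; split=> //; first exact: X_third.
by rewrite -opprD subrr.
Qed.

Lemma X_sqnorm p : X p -> dot p p = 8 / 3.
Proof. by case. Qed.

Lemma line_dot a b d : line_triple X a b d ->
  [/\ dot a b = - 4 / 3, dot b d = - 4 / 3 & dot a d = - 4 / 3].
Proof.
case=> /X_sqnorm na /X_sqnorm nb /X_sqnorm nd e0.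
have := dot0l a; have := dot0l b; have := dot0l d; rewrite -e0 !dotE.
by rewrite na nb nd (dotC b a) (dotC d a) (dotC d b); split; lra.
Qed.

Lemma line_triple_perm a b d : line_triple X a b d -> line_triple X b a d.
Proof. by case=> ? ? ? e; split=> //; rewrite (addrC b). Qed.

Lemma line_triple_rot a b d : line_triple X a b d -> line_triple X b d a.
Proof. by case=> ? ? ? e; split=> //; rewrite addrC addrA. Qed.

Lemma line_triple_dot a b d p q : line_triple X a b d ->
  [set a; b; d] p -> [set a; b; d] q -> p = q \/ dot p q = - 4 / 3.
Proof.
move=> l_abd; have [ab bd ad] := line_dot l_abd.
by case=> [[->|->]|->] [[->|->]|->]; do ?[by left]; right; rewrite // dotC.
Qed.

Lemma X_neq p q t : X q -> dot p q = t -> t != 8 / 3 -> p != q.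
Proof. by move=> /X_sqnorm nq pq; apply: contraNneq => e; rewrite -pq e nq. Qed.

Lemma collinear_dot p q : X p -> X q -> p != q ->
  collinear (hex_lines X) p q <-> dot p q = - 4 / 3.
Proof.
move=> Xp Xq neq_pq; split=> [[_ [[a [b [d [l_abd ->]]]] lp lq]]|pq].
  by have [e|//] := line_triple_dot l_abd lp lq; rewrite e eqxx in neq_pq.
exists [set p; q; - p - q]; split; [|by left; left|by left; right].
by exists p, q, (- p - q); split=> //; apply: X_lineP.
Qed.

(** The inner products of [p] with the three points sum to 0 and are at most 2/3; one being -4/3,
    the other two attain the bound. *)
Lemma line_dots a b d p : line_triple X a b d -> X p -> p != a -> p != b -> p != d ->
  dot p a = - 4 / 3 -> dot p b = 2 / 3 /\ dot p d = 2 / 3.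
Proof.
move=> [Xa Xb Xd e0] Xp pa pb pd pa_dot.
have := X_dot_le Xp Xb pb; have := X_dot_le Xp Xd pd.
have := dot0r p; rewrite -e0 !dotDr pa_dot; lra.
Qed.

Lemma noncollinear_dot a p q : X a -> X p -> X q ->
  dot p a = - 4 / 3 -> dot q a = - 4 / 3 -> p != q -> p != - a - q -> dot p q = 2 / 3.
Proof.
move=> Xa Xp Xq pa qa pq paq; have l_aq : line_triple X a q (- a - q).
  by apply: X_lineP; rewrite // dotC.
have neq_pa : p != a by apply: (X_neq Xa pa); lra.
by case: (line_dots l_aq Xp neq_pa pq paq pa).
Qed.

(** Within one line the only inner products are 8/3 and -4/3, so the value 2/3 separates lines. *)
Lemma line_neq a b d a' b' d' p q : line_triple X a b d ->
  [set a; b; d] p -> [set a'; b'; d'] q -> dot p q = 2 / 3 ->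
  [set a; b; d] != [set a'; b'; d'].
Proof.
move=> l_abd lp lq pq.
have [t1 t2] : 2 / 3 != 8 / 3 :> R /\ 2 / 3 != - 4 / 3 :> R by split; lra.
apply/eqP => eq_l; rewrite -eq_l in lq.
have Xp : X p by case: l_abd lp => Xa Xb Xd _ [[]|] ->.
have [e|e] := line_triple_dot l_abd lp lq; last by rewrite -pq e eqxx in t2.
by move: t1; rewrite -pq -e X_sqnorm ?eqxx.
Qed.

(* Otherwise [a, b, q, p] and the four lines joining them would form an 8-cycle
   in the incidence graph, whose girth is 12. *)
Lemma no_quadrangle a b q p : X a -> X b -> X q -> X p ->
  dot a b = - 4 / 3 -> dot b q = - 4 / 3 -> dot q p = - 4 / 3 -> dot p a = - 4 / 3 ->
  dot a q = 2 / 3 -> dot b p = 2 / 3 -> False.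
Proof.
move=> Xa Xb Xq Xp ab bq qp pa aq bp.
have [_ _ _ _ [_ girth]] := X_hex.
pose l (e f : 'rV[R]_n) := [set e; f; - e - f].
pose s : seq ('rV[R]_n + set 'rV[R]_n)%type :=
  [:: inl a; inr (l a b); inl b; inr (l b q); inl q; inr (l q p); inl p; inr (l p a)].
have hexl e f : X e -> X f -> dot e f = - 4 / 3 -> hex_lines X (l e f).
  by move=> Xe Xf ef; exists e, f, (- e - f); split=> //; apply: X_lineP.
have l1 e f : l e f e by left; left.
have l2 e f : l e f f by left; right.
have adjl e f : X e -> X f -> dot e f = - 4 / 3 ->
    inc_adj X (hex_lines X) (inl e) (inr (l e f)) /\
    inc_adj X (hex_lines X) (inr (l e f)) (inl f).
  by move=> Xe Xf ef; split; apply/asboolP; split=> //; apply: hexl.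
have /girth : ucycle (inc_adj X (hex_lines X)) s; last by move=> /(_ isT).
have [ab1 ab2] := adjl _ _ Xa Xb ab; have [bq1 bq2] := adjl _ _ Xb Xq bq.
have [qp1 qp2] := adjl _ _ Xq Xp qp; have [pa1 pa2] := adjl _ _ Xp Xa pa.
apply/andP; split; first by move: ab1 ab2 bq1 bq2 qp1 qp2 pa1 pa2 => /= -> -> -> -> -> -> -> ->.
have nl e f e' f' p1 p2 : X e -> X f -> dot e f = - 4 / 3 ->
    l e f p1 -> l e' f' p2 -> dot p1 p2 = 2 / 3 ->
    (inr (l e f) == inr (l e' f') :> 'rV[R]_n + set 'rV[R]_n) = false.
  move=> Xe Xf ef le lf /(line_neq (X_lineP Xe Xf ef) le lf)/eqP ne.
  by apply/eqP => -[].
have neq e f t : X f -> dot e f = t -> t != 8 / 3 -> e != f by move=> Xf /(X_neq Xf); apply.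
have qa : dot q a = 2 / 3 by rewrite dotC.
have pb : dot p b = 2 / 3 by rewrite dotC.
have [t1 t2] : 2 / 3 != 8 / 3 :> R /\ - 4 / 3 != 8 / 3 :> R by split; lra.
have ab_bq : (inr (l a b) == inr (l b q) :> 'rV[R]_n + set 'rV[R]_n) = false
  by apply: (nl _ _ _ _ a q).
have ab_qp : (inr (l a b) == inr (l q p) :> 'rV[R]_n + set 'rV[R]_n) = false
  by apply: (nl _ _ _ _ a q).
have ab_pa : (inr (l a b) == inr (l p a) :> 'rV[R]_n + set 'rV[R]_n) = false
  by apply: (nl _ _ _ _ b p).
have bq_qp : (inr (l b q) == inr (l q p) :> 'rV[R]_n + set 'rV[R]_n) = false
  by apply: (nl _ _ _ _ b p).
have bq_pa : (inr (l b q) == inr (l p a) :> 'rV[R]_n + set 'rV[R]_n) = false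
  by apply: (nl _ _ _ _ b p).
have qp_pa : (inr (l q p) == inr (l p a) :> 'rV[R]_n + set 'rV[R]_n) = false
  by apply: (nl _ _ _ _ q a).
have n_ab := neq _ _ _ Xb ab t2; have n_aq := neq _ _ _ Xq aq t1.
have n_pa := neq _ _ _ Xa pa t2; have n_bq := neq _ _ _ Xq bq t2.
have n_bp := neq _ _ _ Xp bp t1; have n_qp := neq _ _ _ Xp qp t2.
have eq_inl (e f : 'rV[R]_n) : (inl e == inl f :> 'rV[R]_n + set 'rV[R]_n) = (e == f) by [].
have eq_lr (e : 'rV[R]_n) (f : set 'rV[R]_n) : (inl e == inr f) = false by [].
have eq_rl (e : 'rV[R]_n) (f : set 'rV[R]_n) : (inr f == inl e) = false by [].
rewrite /s !cons_uniq !inE ab_bq ab_qp ab_pa bq_qp bq_pa qp_pa !(eq_inl, eq_lr, eq_rl).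
by rewrite !negb_or [a == p]eq_sym n_ab n_aq n_pa n_bq n_bp n_qp.
Qed.

(** Let [q' = - b - q] be the third point of the line [bq]. Since (p, b) = 2/3, the products (p, q)
    and (p, q') sum to -2/3; written as 2/3 - k and 2/3 - k' they have k + k' = 2. If k is 0 or 2,
    then [p] is collinear with [q'] or [q], which closes a quadrangle with [a] and [b]. So k = 1. *)
Lemma opposite_dot a b d p q : line_triple X a b d -> X p -> X q ->
  p != a -> p != b -> p != d -> q != a -> q != b -> q != d ->
  dot p a = - 4 / 3 -> dot q b = - 4 / 3 -> dot p q = - 1 / 3.
Proof.
move=> l_abd Xp Xq pa_n pb_n pd_n qa_n qb_n qd_n pa qb.
have [pb pd] := line_dots l_abd Xp pa_n pb_n pd_n pa.
have [qa qd] := line_dots (line_triple_perm l_abd) Xq qb_n qa_n qd_n qb.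
have [ab _ _] := line_dot l_abd; have [Xa Xb Xd _] := l_abd.
have [Xq' bq] : X (- b - q) /\ dot b q = - 4 / 3 by split; [apply: X_third|]; rewrite // dotC.
have bb := X_sqnorm Xb; have qq := X_sqnorm Xq.
have bq' : dot b (- b - q) = - 4 / 3 by rewrite !dotE bb bq; lra.
have aq' : dot a (- b - q) = 2 / 3 by rewrite !dotE ab (dotC a) qa; lra.
have pq' : dot p (- b - q) = - 2 / 3 - dot p q by rewrite !dotE pb; lra.
have neq_pq : p != q by apply: contra_eq_neq qb => <-; rewrite pb; apply/eqP; lra.
have neq_pq' : p != - b - q.
  by apply: contra_eq_neq bq' => <-; rewrite dotC pb; apply/eqP; lra.
have [k ek] := X_dot_vals Xp Xq neq_pq; have [k' ek'] := X_dot_vals Xp Xq' neq_pq'.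
have : k + k' = 2%N.
  apply/eqP; rewrite -(eqr_nat R) natrD; apply/eqP; lra.
have bp : dot b p = 2 / 3 by rewrite dotC.
have aq : dot a q = 2 / 3 by rewrite dotC.
case: k ek => [|[|[|k]]] ek; rewrite ?addSn //.
- by move=> _; case: (@no_quadrangle a b (- b - q) p) => //; rewrite dotC pq' ek; lra.
- by move=> _; rewrite ek; lra.
- by move=> _; case: (@no_quadrangle a b q p) => //; rewrite dotC ek; lra.
Qed.

Lemma set3_swap (T : Type) (a b d : T) : [set a; b; d] = [set a; d; b].
Proof. by rewrite -!setUA (setUC [set b]). Qed.

Lemma set3_rot (T : Type) (a b d : T) : [set a; b; d] = [set d; a; b].
Proof. by rewrite setUC setUA. Qed.

Lemma line_through a l : hex_lines X l -> l a ->
  exists p, [/\ X p, dot p a = - 4 / 3 & l = [set a; p; - a - p]].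
Proof.
have third e f g : line_triple X e f g -> g = - e - f.
  by case=> _ _ _ /eqP; rewrite addrC addr_eq0 opprD => /eqP.
suff step e f g : line_triple X e f g ->
    exists p, [/\ X p, dot p e = - 4 / 3 & [set e; f; g] = [set e; p; - e - p]].
  case=> e [f [g [l_efg ->]]] [[->|->]|->]; first exact: step l_efg.
    by rewrite set3_rot set3_rot; apply: step; apply: line_triple_rot.
  by rewrite set3_rot; apply: step; do 2 apply: line_triple_rot.
move=> l_efg; exists f; rewrite -(third _ _ _ l_efg); split=> //.
  by case: l_efg.
by rewrite dotC; case: (line_dot l_efg).
Qed.

(** One point is chosen on each of the other eight lines through [a]; points on distinct lines
    through [a] have inner product 2/3. *)
Lemma eight_neighbours a b d : line_triple X a b d ->
  exists f : 'I_8 -> 'rV[R]_n,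
    (forall i, [/\ X (f i), f i != a, f i != b, f i != d & dot (f i) a = - 4 / 3]) /\
    (forall i j, i != j -> dot (f i) (f j) = 2 / 3).
Proof.
move=> l_abd; have [ab _ ad] := line_dot l_abd; have [Xa Xb Xd e0] := l_abd.
have [_ _ nine _ _] := X_hex.
have /card_set_bijP[g0 bij_g0] : `I_9 #= [set l | hex_lines X l /\ l a].
  by rewrite card_eq_sym; apply: nine.
have [g [g_lines g_inj g_surj]] : exists g : 'I_9 -> set 'rV[R]_n,
    [/\ forall i, hex_lines X (g i) /\ g i a, injective g & exists i, g i = [set a; b; d]].
  case: bij_g0 => g0_fun g0_inj g0_surj; exists (fun i => g0 i); split.
  - by move=> i; apply: (g0_fun i); apply: ltn_ord.
  - by move=> i j /g0_inj/val_inj; apply; rewrite inE; apply: ltn_ord.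
  have [|i lt_i def_i] := g0_surj [set a; b; d]; last by exists (Ordinal lt_i).
  by split; [exists a, b, d | left; left].
case: g_surj => i0 g_i0.
(* [lift i0] enumerates the lines through [a] while skipping the given one, whose index is [i0]. *)
have /choice[f f_line] : forall i, exists p,
    [/\ X p, dot p a = - 4 / 3 & g (lift i0 i) = [set a; p; - a - p]].
  by move=> i; case: (g_lines (lift i0 i)) => /line_through; apply.
have f_other e e' : e' = - a - e -> [set a; b; d] = [set a; e; e'] -> forall i, f i != e.
  move=> -> eq_l i; have [_ _ g_i] := f_line i; apply/eqP => fe.
  have /g_inj : g (lift i0 i) = g i0 by rewrite g_i0 g_i fe eq_l.
  by move/eqP; rewrite eq_sym (negPf (neq_lift i0 i)).
have third : d = - a - b.
  by apply/eqP; rewrite -opprD -addr_eq0 addrC e0.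
exists f; split=> [i|i j neq_ij].
  have [Xf fa _] := f_line i; split=> //.
  - by apply: (X_neq Xa fa); lra.
  - exact: (f_other b d).
  apply: (f_other d b); last exact: set3_swap.
  by rewrite third opprD !opprK addrA addNr add0r.
have [Xi fia gi] := f_line i; have [Xj fja gj] := f_line j.
have neq_g : g (lift i0 i) <> g (lift i0 j).
  by move/g_inj/lift_inj/eqP; rewrite (negPf neq_ij).
apply: (noncollinear_dot Xa) => //; apply/eqP => def_fi; case: neq_g; rewrite gi gj def_fi //.
by rewrite opprD !opprK addrA addNr add0r set3_swap.
Qed.

(** * The three points of the line, their neighbours and the projections *)

Lemma ord3_ind (P : 'I_3 -> Prop) : P 0 -> P 1 -> P 2%:R -> forall i, P i.
Proof.
move=> P0 P1 P2 [[|[|[|i]]] //= lt_i].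
- by have -> : Ordinal lt_i = 0 by apply: val_inj.
- by have -> : Ordinal lt_i = 1 by apply: val_inj.
by have -> : Ordinal lt_i = 2%:R by apply: val_inj.
Qed.

(** Indices are added modulo 3: rotating the line is adding 1, and the index different from distinct
    [i] and [j] is [- i - j]. *)
Definition pt (i : 'I_3) : 'rV[R]_n := if i == 0 then x else if i == 1 then y else z.
Local Notation "p ^^" := (lift3 c p) (at level 2, format "p ^^").
Local Notation e_ i := (evec c (pt i)).

Lemma pt_triple i : line_triple X (pt i) (pt (i + 1)) (pt (i + 1 + 1)).
Proof.
elim/ord3_ind: i => /=; rewrite /pt /=; first exact: xyz_line.
  exact: line_triple_rot.
by do 2 apply: line_triple_rot.
Qed.

Lemma X_pt i : X (pt i).
Proof. by case: (pt_triple i). Qed.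

Lemma pt_dot i j : dot (pt i) (pt j) = 4 * (i == j)%:R - 4 / 3.
Proof.
have [->|] := eqVneq i j; first by rewrite (X_sqnorm (X_pt j)) /=; lra.
have [xy yz xz] := line_dot xyz_line; rewrite mulr0 sub0r.
elim/ord3_ind: i; elim/ord3_ind: j; rewrite /pt //= ?xy ?yz ?xz
  ?(dotC y x) ?(dotC z x) ?(dotC z y) ?xy ?yz ?xz => _; lra.
Qed.

Lemma sum_pt : \sum_i pt i = 0.
Proof.
by rewrite !big_ord_recl big_ord0 addr0 addrA; case: xyz_line.
Qed.

Lemma X_dot_c p : X p -> dot p c = 0.
Proof. by move=> /X_Rspan; apply: c_orth. Qed.

Lemma dot_cc : dot c c = 3. Proof. exact: c_norm. Qed.

Lemma dot_lift p q : X p -> X q -> dot p^^ q^^ = dot p q + 1 / 3.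
Proof.
move=> Xp Xq; rewrite /lift3 !dotE (dotC c q) (X_dot_c Xp) (X_dot_c Xq) dot_cc; lra.
Qed.

Lemma dot_lift_c p : X p -> dot p^^ c = 1.
Proof. by move=> Xp; rewrite /lift3 !dotE (X_dot_c Xp) dot_cc; lra. Qed.

Lemma dot_lift_e p i : X p -> dot p^^ (e_ i) = (dot p (pt i) - 2 / 3) / 2.
Proof.
move=> Xp; have Xi := X_pt i.
by rewrite dotZr dotDr dotNr (dot_lift Xp Xi) (dot_lift_c Xp); lra.
Qed.

Lemma dot_c_e i : dot c (e_ i) = -1.
Proof. by rewrite dotZr dotDr dotNr dotC (dot_lift_c (X_pt i)) dot_cc; lra. Qed.

Lemma dot_e_e i j : dot (e_ i) (e_ j) = (i == j)%:R.
Proof.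
by rewrite dotZl dotDl dotNl (dot_lift_e _ (X_pt i)) dot_c_e pt_dot; lra.
Qed.

Lemma c_sum_e : c = - \sum_i e_ i.
Proof.
rewrite -scaler_sumr sumrB big_split /= sum_pt add0r !sumr_const card_ord -!scaler_nat.
rewrite !scalerA divff ?pnatr_eq0 // scale1r -{2}[c]scale1r -scalerBl scalerA -scaleNr.
rewrite (_ : - _ = 1) ?scale1r //; lra.
Qed.

Lemma lift_pt i : (pt i)^^ = 2 *: e_ i + c.
Proof. by rewrite scalerA divff ?pnatr_eq0 // scale1r subrK. Qed.

Lemma pt_third i j : i != j -> - pt i - pt j = pt (- i - j).
Proof.
have [_ _ _ def_z] := X_xyz.
elim/ord3_ind: i; elim/ord3_ind: j => //= _; rewrite /pt /= def_z;
  by apply/rowP => k; rewrite !mxE; lra.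
Qed.

Definition nb (i : 'I_3) p : Prop := [/\ X p, forall j, p != pt j & dot p (pt i) = - 4 / 3].

Lemma nb_dot i p j : nb i p -> dot p (pt j) = 2 / 3 - 2 * (i == j)%:R.
Proof.
case=> Xp neq_p pi; have [d1 d2] := line_dots (pt_triple i) Xp (neq_p _) (neq_p _) (neq_p _) pi.
have [<-|] := eqVneq i j; first by rewrite pi /=; lra.
rewrite mulr0 subr0; elim/ord3_ind: i pi d1 d2; elim/ord3_ind: j => //= _ d1 d2 _;
  by rewrite -?d1 -?d2; congr dot; congr pt; apply: val_inj.
Qed.

Lemma off_lineP p : (~ [set x; y; z] p) <-> (forall j, p != pt j).
Proof.
split=> [off_p j|neq_p [[]|] def_p].
- apply/eqP => def_p; apply: off_p; rewrite def_p.
  by elim/ord3_ind: j {def_p}; [left; left|left; right|right].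
- by have := neq_p 0; rewrite def_p eqxx.
- by have := neq_p 1; rewrite def_p eqxx.
by have := neq_p 2%:R; rewrite def_p eqxx.
Qed.

Lemma nbrsP i p : nbrs X x y z (pt i) p <-> nb i p.
Proof.
split=> [[Xp /off_lineP neq_p /collinear_dot]|[Xp neq_p pi]].
  by move=> e; split=> //; apply: e => //; apply: X_pt.
by split=> //; [apply/off_lineP | apply/collinear_dot => //; apply: X_pt].
Qed.

Lemma KprojE p : Kproj c x y z p = p^^ - \sum_i dot p^^ (e_ i) *: e_ i.
Proof. by rewrite !big_ord_recl big_ord0 addr0 addrA. Qed.

Lemma Kproj_orth p i : dot (Kproj c x y z p) (e_ i) = 0.
Proof.
rewrite KprojE dotDl dotNl dot_suml (bigD1 i) //= big1 => [|j ji].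
  by rewrite dotZl dot_e_e eqxx mulr1 addr0 subrr.
by rewrite dotZl dot_e_e (negPf ji) mulr0.
Qed.

Lemma nb_lift_e i p j : nb i p -> dot p^^ (e_ j) = - (i == j)%:R.
Proof. by move=> nbp; rewrite dot_lift_e ?(nb_dot j nbp); [lra | case: nbp]. Qed.

Lemma nb_Kproj i p : nb i p -> Kproj c x y z p = p^^ + e_ i.
Proof.
move=> nbp; rewrite KprojE (bigD1 i) //= big1 => [|j ji].
  by rewrite (nb_lift_e _ nbp) eqxx addr0 scaleN1r opprK.
by rewrite (nb_lift_e _ nbp) eq_sym (negPf ji) oppr0 scale0r.
Qed.

Lemma Kproj_dot i j p q : nb i p -> nb j q ->
  dot (Kproj c x y z p) (Kproj c x y z q) = dot p q + 1 / 3 - (i == j)%:R.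
Proof.
move=> nbp nbq; rewrite (nb_Kproj nbq) dotDr Kproj_orth addr0 (nb_Kproj nbp) dotDl.
rewrite dot_lift; try by case: nbp; case: nbq.
by rewrite dotC [dot (e_ i) _]dotC (nb_lift_e _ nbq) (eq_sym j) dotC; lra.
Qed.

Lemma nb_third i p : nb i p -> nb i (- p - pt i).
Proof.
move=> nbp; have [Xp neq_p pi] := nbp; have Xpi := X_pt i; have pp := X_sqnorm Xpi.
split; [exact: X_third | move=> j | by rewrite !dotE pi pp; lra].
apply/eqP => def_j; have e1 : dot (- p - pt i) p = dot (pt j) p by rewrite def_j.
have e2 : dot (- p - pt i) (pt i) = dot (pt j) (pt i) by rewrite def_j.
move: e1 e2; rewrite !dotE (dotC (pt i) p) (dotC (pt j) p) pi (X_sqnorm Xp) pp.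
by rewrite (nb_dot j nbp) pt_dot eq_sym; lra.
Qed.

(** This is why neighbours give root pairs: the two points other than [pt i] on a line through it
    project to opposite vectors, because 2 e_i = pt i - 2c/3. *)
Lemma Kproj_third i p : nb i p -> Kproj c x y z (- p - pt i) = - Kproj c x y z p.
Proof.
move=> nbp; rewrite (nb_Kproj (nb_third nbp)) (nb_Kproj nbp) /evec /lift3.
apply/rowP => k; rewrite !mxE; lra.
Qed.

(** By [Kproj_dot] the inner product is (p, q) + 1/3 - [i = j]. For distinct [i], [j] one has (p, q)
    = -1/3; for distinct lines through one point, (p, q) = 2/3. Both give 0. *)
Lemma Kproj_cases i j p q : nb i p -> nb j q ->
  [\/ i = j /\ p = q, i = j /\ q = - p - pt i
    | dot (Kproj c x y z p) (Kproj c x y z q) = 0].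
Proof.
move=> nbp nbq; rewrite (Kproj_dot nbp nbq).
have [Xp neq_p pi] := nbp; have [Xq neq_q qj] := nbq.
have [eq_ij|neq_ij] := eqVneq i j; last first.
  have ij : dot (pt i) (pt j) = - 4 / 3 by rewrite pt_dot (negPf neq_ij) /=; lra.
  have := X_lineP (X_pt i) (X_pt j) ij; rewrite pt_third // => l_ij.
  by constructor 3; rewrite (opposite_dot l_ij) //=; lra.
subst j; have [<-|neq_pq] := eqVneq p q; first by constructor 1.
have [->|neq_qp] := eqVneq q (- p - pt i); first by constructor 2.
constructor 3; rewrite (noncollinear_dot (X_pt i)) //=; first lra.
apply: contraNneq neq_qp => ->.
by rewrite opprD !opprK addrAC subrr add0r.
Qed.

(** * The lattices of the line *)

Local Notation M := (glueM L Cp Cm c).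
Local Notation S := (Sline c x y z).
Local Notation I := (Iline c x y z).
Local Notation K := (Kline M c x y z).
Local Notation G := (Gamma M c x y z).

Lemma L_3x : L (3 *: x).
Proof.
have [Xx Xy Xz def_z] := X_xyz.
have -> : 3 *: x = (x - y) + (x - z).
  by rewrite def_z; apply/rowP => i; rewrite !mxE; lra.
by apply: LD; apply/CpP; [exact: Xy.1 | exact: Xx.1 | exact: Xz.1 | exact: Xx.1].
Qed.

(* Since [3 x] lies in [L], the three layers of [M] make up [L + Z (x + c / 3)]. *)
Lemma glueMP v : M v <-> exists (l : 'rV[R]_n) (k : int), L l /\ v = l + k%:~R *: x^^.
Proof.
have [Xx _ _ _] := X_xyz.
have L3 k : L (k%:~R *: (3 *: x)) by apply/LZ/L_3x.
split.
  case=> [[|]|] [a Aa [k ->]].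
  - exists (a - k%:~R *: (3 *: x)), (3 * k); split; first exact: LB.
    by apply/rowP => i; rewrite !mxE intrM; lra.
  - exists (a - x - k%:~R *: (3 *: x)), (1 + 3 * k); split.
      by apply: LB => //; apply/(CpP _ Xx.1).
    by apply/rowP => i; rewrite !mxE intrD intrM; lra.
  exists (a + x - k%:~R *: (3 *: x)), (3 * k - 1); split.
    apply: LB => //; move: Aa; rewrite Cm_opp => -[b Cb <-].
    by rewrite addrC; apply/(CpP x Cb); case: Xx.
  by apply/rowP => i; rewrite !mxE intrB intrM; lra.
case=> l [k [Ll ->]].
have [m def_k] : exists m, k = 3 * m \/ k = 3 * m + 1 \/ k = 3 * m - 1.
  by exists (divz (k + 1) 3); lia.
have Cpx a : Cp (x + a) <-> L a by rewrite (CpP _ Xx.1) addrC addKr.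
case: def_k => [|[]] ->.
- left; left; exists (l + m%:~R *: (3 *: x)); first exact: LD.
  by exists m; apply/rowP => i; rewrite !mxE intrM; lra.
- left; right; exists (x + (l + m%:~R *: (3 *: x))); first exact/Cpx/LD.
  by exists m; apply/rowP => i; rewrite !mxE intrD intrM; lra.
right; exists (- (x + - (l + m%:~R *: (3 *: x)))).
  by rewrite Cm_opp; exists (x + - (l + m%:~R *: (3 *: x))) => //; apply/Cpx/LN/LD.
by exists m; apply/rowP => i; rewrite !mxE intrB intrM; lra.
Qed.

Lemma MD v w : M v -> M w -> M (v + w).
Proof.
move=> /glueMP[l1 [k1 [L1 ->]]] /glueMP[l2 [k2 [L2 ->]]]; apply/glueMP.
by exists (l1 + l2), (k1 + k2); rewrite intrD scalerDl addrACA; split; first exact: LD.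
Qed.

Lemma MZ (k : int) v : M v -> M (k%:~R *: v).
Proof.
move=> /glueMP[l1 [k1 [L1 ->]]]; apply/glueMP.
by exists (k%:~R *: l1), (k * k1); rewrite intrM scalerDr scalerA; split; first exact: LZ.
Qed.

Lemma MN v : M v -> M (- v).
Proof. by move=> /(MZ (-1)); rewrite rmorphN1 scaleN1r. Qed.

Lemma MB v w : M v -> M w -> M (v - w).
Proof. by move=> Mv /MN; apply: MD. Qed.

Lemma M_L l : L l -> M l.
Proof. by move=> Ll; apply/glueMP; exists l, 0; rewrite scale0r addr0. Qed.

Lemma M_0 : M 0. Proof. exact/M_L/L0. Qed.

Lemma M_sum (J : finType) (F : J -> 'rV[R]_n) : (forall j, M (F j)) -> M (\sum_j F j).
Proof. by move=> MF; apply: (big_ind M) => //; [exact: M_0 | exact: MD]. Qed.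

Lemma M_lift p : Cp p -> M p^^.
Proof.
have [Xx _ _ _] := X_xyz; move=> Cp_p; apply/glueMP; exists (p - x), 1.
split; first by apply/(CpP _ Xx.1).
by rewrite scale1r /lift3 addrA subrK.
Qed.

Lemma M_c : M c.
Proof.
have def_c : c = 3%:~R *: x^^ - 3 *: x by apply/rowP => i; rewrite !mxE; lra.
by rewrite {2}def_c; apply: MB; [apply/MZ/M_lift; case: X_xyz => -[] | apply/M_L/L_3x].
Qed.

Lemma L_dot_c l : L l -> dot l c = 0.
Proof. by move=> Ll; apply/c_orth/Rspan_gen. Qed.

Lemma L_dot_lift l p : L l -> dot l p^^ = dot l p.
Proof. by move=> Ll; rewrite dotDr dotZr L_dot_c // mulr0 addr0. Qed.

Lemma dot_lift_x : dot x^^ x^^ = 3%:R.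
Proof. by have [Xx _ _ _] := X_xyz; rewrite dot_lift // X_sqnorm //; lra. Qed.

Lemma M_int v w : M v -> M w -> dot v w \is a Num.int.
Proof.
have [Xx _ _ _] := X_xyz; have x_int := (Cp_dual Xx.1).2.
move=> /glueMP[l1 [k1 [L1 ->]]] /glueMP[l2 [k2 [L2 ->]]].
rewrite !dotDl !dotZl !dotDr !dotZr dot_lift_x L_dot_lift //.
rewrite [dot x^^ l2]dotC L_dot_lift // ![dot _ x]dotC.
by do !apply: rpredD; rewrite ?rpredM ?rpred_int ?rpred_nat ?x_int ?L_integral //
  rpredD ?rpredM ?rpred_int ?rpred_nat ?x_int.
Qed.

(** For v = l + k u with u = x + c/3 of norm 3, the norm is congruent to 3k^2 modulo 2, hence to k =
    (v, c). *)
Lemma M_characteristic v : M v -> exists m : int, sqnorm v = dot v c + 2 * m%:~R.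
Proof.
have [Xx _ _ _] := X_xyz; have x_int := (Cp_dual Xx.1).2.
move=> /glueMP[l [k [Ll ->]]]; have [m em] := L_even Ll.
have /intrP[m' em'] := x_int _ Ll.
have [h eh] : exists h : int, 3 * (k * k) - k = 2 * h.
  have [j [->|->]] : exists j, k = 2 * j \/ k = 2 * j + 1 by exists (divz k 2); lia.
    by exists (6 * j * j - j); ring.
  by exists (6 * j * j + 5 * j + 1); ring.
exists (m + k * m' + h); rewrite /sqnorm !dotDl !dotZl !dotDr !dotZr dot_lift_x.
rewrite [dot x^^ l]dotC L_dot_lift // [dot _ x]dotC em' L_dot_c // dot_lift_c //.
rewrite [dot l l]em !intrD intrM.
have := congr1 (fun j : int => j%:~R : R) eh; rewrite /= intrB !intrM; lra.
Qed.

(** The real span of [M], of rank at most 27, kept explicit because the ambient dimension [n] is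
    arbitrary. *)
Definition hexspace : 'M[R]_n := (B + c)%MS.
Local Notation V := hexspace.

Lemma Rspan_L_V a : Rspan L a -> (a <= V)%MS.
Proof. by move=> /(Rspan_basisP _ L_basis) aB; apply: submx_trans aB (addsmxSl _ _). Qed.

Lemma c_V : (c <= V)%MS. Proof. exact: addsmxSr. Qed.

Lemma M_V v : M v -> (v <= V)%MS.
Proof.
move=> /glueMP[l [k [Ll ->]]]; rewrite addmx_sub ?scalemx_sub //.
  exact/Rspan_L_V/Rspan_gen.
rewrite addmx_sub ?scalemx_sub ?c_V //; apply/Rspan_L_V/X_Rspan.
by case: X_xyz.
Qed.

(** Write v = a + s c. Pairing with [L] puts [a] in the dual of [L], so in one of its three cosets;
    pairing with x + c/3 makes (a, x) + s integral, which fixes [s] modulo 1 as the gluing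
    prescribes. *)
Lemma M_self_dual v : (v <= V)%MS -> (forall m, M m -> dot v m \is a Num.int) -> M v.
Proof.
have [Xx _ _ _] := X_xyz; have x_int := (Cp_dual Xx.1).2.
case/sub_addsmxP => -[q t] /= -> v_int; set a := q *m B; pose s := t 0 0.
have tc : t *m c = s *: c by rewrite [t]mx11_scalar mul_scalar_mx.
have Ra : Rspan L a by apply/(Rspan_basisP _ L_basis)/submxMl.
rewrite tc in v_int *.
have La l : L l -> dot a l \is a Num.int.
  by move=> Ll; have := v_int l (M_L Ll); rewrite !dotE [dot c l]dotC L_dot_c // mulr0 addr0.
have := v_int _ (M_lift Xx.1); rewrite dotDl dotZl [dot c _]dotC dot_lift_c // mulr1.
rewrite dotDr dotZr c_orth // mulr0 addr0 => st.
have cosetx b : Cp b -> dot b x - 8 / 3 \is a Num.int.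
  move=> Cb; rewrite -(X_sqnorm Xx) -dotNl -dotDl [dot _ _]dotC; apply: x_int.
  exact/(CpP b Xx.1).
have [La'|Cpa|Cpa] := dual_cases (conj Ra La).
- have /intrP[m ->] : s \is a Num.int.
    by rewrite -(addKr (dot a x) s) rpredD // rpredN [dot a x]dotC x_int.
  by apply: MD; [exact: M_L | exact/MZ/M_c].
- have /intrP[m def_m] : s - 1 / 3 \is a Num.int.
    have -> : s - 1 / 3 = (dot a x + s) - (dot a x - 8 / 3) - 3%:R by lra.
    exact: rpredB (rpredB st (cosetx _ Cpa)) (rpred_nat _ 3).
  have -> : a + s *: c = a^^ + m%:~R *: c.
    by rewrite -def_m; apply/rowP => i; rewrite !mxE; lra.
  by apply: MD; [exact: M_lift | exact/MZ/M_c].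
have /intrP[m def_m] : s + 1 / 3 \is a Num.int.
  have -> : s + 1 / 3 = (dot a x + s) + (dot (- a) x - 8 / 3) + 3%:R by rewrite dotNl; lra.
  exact: rpredD (rpredD st (cosetx _ Cpa)) (rpred_nat _ 3).
have -> : a + s *: c = - (- a)^^ + m%:~R *: c.
  by rewrite -def_m; apply/rowP => i; rewrite !mxE; lra.
by apply: MD; [apply/MN/M_lift | exact/MZ/M_c].
Qed.

(** * The lattices S, I and K *)

Lemma SP s : S s <-> exists m : 'I_3 -> int, s = \sum_i (m i)%:~R *: (pt i)^^.
Proof. exact: (Zspan_pt (fun i => (pt i)^^)). Qed.

Lemma IP s : I s <-> exists m : 'I_3 -> int, s = \sum_i (m i)%:~R *: e_ i.
Proof. exact: (Zspan_pt (fun i => e_ i)). Qed.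

Lemma dot_lift_pt_e i j : dot (pt i)^^ (e_ j) = 2 * (i == j)%:R - 1.
Proof. by rewrite lift_pt dotDl dotZl dot_e_e dot_c_e. Qed.

Lemma I_e i : I (e_ i).
Proof.
apply/IP; exists (fun j => (j == i)%:Z); rewrite (bigD1 i) //= eqxx scale1r.
by rewrite big1 ?addr0 // => j /negPf->; rewrite scale0r.
Qed.

Lemma I_D s1 s2 : I s1 -> I s2 -> I (s1 + s2).
Proof.
move=> /IP[m1 ->] /IP[m2 ->]; apply/IP; exists (fun i => m1 i + m2 i).
by rewrite -big_split; apply: eq_bigr => i _; rewrite intrD scalerDl.
Qed.

Lemma I_Z (k : int) s : I s -> I (k%:~R *: s).
Proof.
move=> /IP[m ->]; apply/IP; exists (fun i => k * m i); rewrite scaler_sumr.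
by apply: eq_bigr => i _; rewrite scalerA intrM.
Qed.

Lemma I_N s : I s -> I (- s).
Proof. by move=> /(I_Z (-1)); rewrite rmorphN1 scaleN1r. Qed.

Lemma I_sum (J : finType) (F : J -> 'rV[R]_n) : (forall j, I (F j)) -> I (\sum_j F j).
Proof.
move=> IF; apply: (big_ind I) => //; last exact: I_D.
by have := I_Z 0 (I_e 0); rewrite scale0r.
Qed.

Lemma I_c : I c.
Proof.
rewrite {2}c_sum_e; apply/I_N/I_sum => i; exact: I_e.
Qed.

Lemma S_I s : S s -> I s.
Proof.
move=> /SP[m ->]; apply: I_sum => i; apply: I_Z; rewrite lift_pt.
by apply: I_D I_c; apply: (I_Z 2); apply: I_e.
Qed.

Lemma S_M s : S s -> M s.
Proof. by move=> /SP[m ->]; apply: M_sum => i; apply/MZ/M_lift; case: (X_pt i). Qed.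

Lemma S_D s1 s2 : S s1 -> S s2 -> S (s1 + s2).
Proof.
move=> /SP[m1 ->] /SP[m2 ->]; apply/SP; exists (fun i => m1 i + m2 i).
by rewrite -big_split; apply: eq_bigr => i _; rewrite intrD scalerDl.
Qed.

Lemma S_0 : S 0.
Proof. by apply/SP; exists (fun=> 0); rewrite big1 // => i _; rewrite scale0r. Qed.

Lemma orth_e_I a s : (forall i, dot a (e_ i) = 0) -> I s -> dot a s = 0.
Proof.
move=> orth_a /IP[m ->]; rewrite dotC dot_suml big1 // => i _.
by rewrite dotZl dotC orth_a mulr0.
Qed.

Lemma sum_lift_pt : \sum_i (pt i)^^ = c.
Proof.
rewrite big_split /= sum_pt add0r sumr_const card_ord -scaler_nat scalerA.
by rewrite divff ?pnatr_eq0 // scale1r.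
Qed.

Lemma KP a : K a <-> M a /\ forall i, dot a (e_ i) = 0.
Proof.
split=> -[Ma orth_a]; split=> //; last by move=> s /S_I; apply: orth_e_I.
move=> i; have Su j : dot a (pt j)^^ = 0.
  apply: orth_a; apply/SP; exists (fun k => (k == j)%:Z); rewrite (bigD1 j) //= eqxx scale1r.
  by rewrite big1 ?addr0 // => k /negPf->; rewrite scale0r.
have ac : dot a c = 0.
  by rewrite -{1}sum_lift_pt dotC dot_suml big1 // => j _; rewrite dotC Su.
by rewrite /evec dotZr dotDr dotNr Su ac subr0 mulr0.
Qed.

(** * The lattice Gamma: membership, integrality and evenness *)

Lemma Rspan_K a : Rspan K a -> (a <= V)%MS /\ forall i, dot a (e_ i) = 0.
Proof.
move: a; apply: Rspan_min => [|a b [Va oa] [Vb ob]|t a /KP[Ma oa]].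
- by split=> [|i]; [exact: sub0mx | exact: dot0l].
- by split=> [|i]; [exact: addmx_sub | rewrite dotDl oa ob addr0].
by split=> [|i]; [exact/scalemx_sub/M_V | rewrite dotZl oa mulr0].
Qed.

Lemma Rspan_D A a b : Rspan A a -> Rspan A b -> Rspan A (a + b).
Proof.
move=> [k1 [m1 [t1 [At1 ->]]]] [k2 [m2 [t2 [At2 ->]]]].
exists (k1 + k2)%N, (fun i => match fintype.split i with inl j => m1 j | inr j => m2 j end),
  (fun i => match fintype.split i with inl j => t1 j | inr j => t2 j end); split.
  by move=> i; case: (fintype.split i).
rewrite big_split_ord /=; congr (_ + _); apply: eq_bigr => i _.
  by have -> : fintype.split (lshift k2 i) = inl i := unsplitK (inl i).
by have -> : fintype.split (rshift k1 i) = inr i := unsplitK (inr i).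
Qed.

Lemma Rspan_Z A t a : Rspan A a -> Rspan A (t *: a).
Proof.
move=> [k [m [f [Af ->]]]]; exists k, (fun i => t * m i), f; split=> //.
by rewrite scaler_sumr; apply: eq_bigr => i _; rewrite scalerA.
Qed.

(** The working description of Gamma, free of cosets. Two vectors glued to the same class modulo [S]
    differ by an element of [M] orthogonal to [S], so by an element of [K]; membership of [a] in the
    dual of [K] follows from integrality of [M]. *)
Lemma GP a : G a <-> Rspan K a /\ exists2 s, I s & M (s + a).
Proof.
split.
  case=> [[Ra _]] [_ [s0 I0 <-]] eq_psi; split=> //.
  have : Defs.coset K a a.
    by exists 0; [apply/KP; split=> [|i]; [exact: M_0 | exact: dot0l] | rewrite addr0].
  rewrite -eq_psi => -[_ [_ [s' Ss' <-] Msa]]; exists (s0 + s') => //.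
  exact: I_D (S_I Ss').
case=> Ra [s Is Msa]; have [_ orth_a] := Rspan_K Ra.
have dual_a : dual_lattice K a.
  split=> // b /KP[Mb orth_b]; have := M_int Msa Mb.
  by rewrite dotDl [dot s b]dotC (orth_e_I orth_b Is) add0r.
split=> //; exists (Defs.coset S s); first by exists s.
apply/seteqP; split=> [k [[Rk _] [_ [s' Ss' <-] Msk]]|_ [b /KP[Mb orth_b] <-]].
  have [_ orth_k] := Rspan_K Rk; exists (k - a); last by rewrite addrC subrK.
  apply/KP; split=> [|i]; last by rewrite dotDl dotNl orth_a orth_k subr0.
  have -> : k - a = (s + s' + k) - (s + a) - s'.
    by apply/rowP => i; rewrite !mxE; lra.
  by apply: MB; [exact: MB | exact: S_M].
split.
  split=> [|b' Kb']; first by apply: Rspan_D Ra _; apply/Rspan_gen/KP.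
  by rewrite dotDl rpredD ?dual_a.2 // M_int //; case/KP: Kb'.
exists (s + 0); first by exists 0; first exact: S_0.
by rewrite addr0 addrA; apply: MD.
Qed.

Lemma GD a b : G a -> G b -> G (a + b).
Proof.
move=> /GP[Ra [s Is Ms]] /GP[Rb [t It Mt]]; apply/GP; split; first exact: Rspan_D.
by exists (s + t); [exact: I_D | rewrite addrACA; exact: MD].
Qed.

Lemma GN a : G a -> G (- a).
Proof.
move=> /GP[Ra [s Is Ms]]; apply/GP; split; first by rewrite -scaleN1r; apply: Rspan_Z.
by exists (- s); [exact: I_N | rewrite -opprD; exact: MN].
Qed.

Lemma G_dot a s t b : (forall i, dot a (e_ i) = 0) -> (forall i, dot b (e_ i) = 0) ->
  I s -> I t -> dot (s + a) (t + b) = dot s t + dot a b.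
Proof.
move=> orth_a orth_b Is It; rewrite dotDl !dotDr [dot s b]dotC.
by rewrite (orth_e_I orth_a It) (orth_e_I orth_b Is) addr0 add0r.
Qed.

Lemma I_dot (m1 m2 : 'I_3 -> int) :
  dot (\sum_i (m1 i)%:~R *: e_ i) (\sum_i (m2 i)%:~R *: e_ i) = \sum_i (m1 i * m2 i)%:~R.
Proof.
rewrite dot_suml; apply: eq_bigr => i _; rewrite dotZl dotC dot_suml (bigD1 i) //= big1.
  by rewrite dotZl dot_e_e eqxx mulr1 addr0 intrM.
by move=> j /negPf ji; rewrite dotZl dot_e_e ji mulr0.
Qed.

(** By orthogonality (a, b) = (s + a, t + b) - (s, t), a difference of inner products taken in [M]
    and in [I]. *)
Lemma G_integral : integral_lattice G.
Proof.
move=> a b /GP[/Rspan_K[_ orth_a] [s Is Ms]] /GP[/Rspan_K[_ orth_b] [t It Mt]].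
have := M_int Ms Mt; rewrite G_dot //; have [m ->] := (IP s).1 Is; have [k ->] := (IP t).1 It.
rewrite I_dot => h; rewrite -(addKr (\sum_i (m i * k i)%:~R) (dot a b)) rpredD // rpredN.
by apply: rpred_sum => i _; apply: rpred_int.
Qed.

(** The vector [c] is characteristic both for [M] and for [I], where it is minus the sum of the
    orthonormal basis. So the norms of [s + a] and of [s] are both congruent to (s, c) modulo 2. *)
Lemma G_even : even_lattice G.
Proof.
move=> a /GP[/Rspan_K[_ orth_a] [s Is Ms]]; have [m] := M_characteristic Ms.
rewrite /sqnorm G_dot // dotDl (orth_e_I orth_a I_c) addr0.
have [k ->] := (IP s).1 Is; rewrite I_dot dot_suml.
have -> : \sum_i dot ((k i)%:~R *: e_ i) c = \sum_i (- k i)%:~R.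
  by apply: eq_bigr => i _; rewrite dotZl dotC dot_c_e mulrN1 intrN.
rewrite -!rmorph_sum /= => e.
have [h eh] : exists h : int, \sum_i k i * k i + \sum_i k i = 2 * h.
  have /choice[f ef] : forall i, exists h, k i * k i + k i = 2 * h.
    move=> i; have [j [->|->]] : exists j, k i = 2 * j \/ k i = 2 * j + 1.
    - by exists (divz (k i) 2); lia.
    - by exists (2 * j * j + j); ring.
    by exists (2 * j * j + 3 * j + 1); ring.
  by exists (\sum_i f i); rewrite mulr_sumr -big_split; apply: eq_bigr => i _; apply: ef.
exists (m - h); have := congr1 (fun j : int => j%:~R : R) eh.
by rewrite /= intrB; move: e; rewrite sumrN intrN intrD intrM; lra.
Qed.

(** * Roots from neighbours, self-duality, and all roots of Gamma *)

Lemma nb_root i p : nb i p -> G (Kproj c x y z p) /\ sqnorm (Kproj c x y z p) = 2.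
Proof.
move=> nbp; have [Xp _ _] := nbp; split; last first.
  by rewrite /sqnorm (Kproj_dot nbp nbp) X_sqnorm // eqxx /=; lra.
apply/GP; split.
  (* Twice the projection lies in [K]: it is 2(p + c/3) + (pt i + c/3) - c, an element of [M]
     orthogonal to the e_j. *)
  have n2 : (2 : R) != 0 by rewrite pnatr_eq0.
  rewrite -[Kproj _ _ _ _ _](scalerK n2).
  apply/Rspan_Z/Rspan_gen/KP; split=> [|j]; last by rewrite dotZl Kproj_orth mulr0.
  have -> : 2%:R *: Kproj c x y z p = 2%:~R *: p^^ + ((pt i)^^ - c).
    by rewrite (nb_Kproj nbp) lift_pt addrK scalerDr.
  apply: MD; [apply/MZ/M_lift | apply: MB M_c; apply: M_lift]; first by case: Xp.
  by case: (X_pt i).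
exists (- e_ i); first exact/I_N/I_e.
rewrite (nb_Kproj nbp) addrC addrK; apply: M_lift; by case: Xp.
Qed.

Lemma ord3_shift (i j : 'I_3) : [\/ j = i, j = i + 1 | j = i + 1 + 1].
Proof.
elim/ord3_ind: i; elim/ord3_ind: j;
  (try by constructor 1; apply: val_inj); (try by constructor 2; apply: val_inj);
  by constructor 3; apply: val_inj.
Qed.

Lemma frame_exists : exists (F : 'I_24 -> 'rV[R]_n) (t : 'I_24 -> 'I_3),
  (forall k, nb (t k) (F k)) /\
  (forall k l, k != l -> dot (Kproj c x y z (F k)) (Kproj c x y z (F l)) = 0).
Proof.
have /choice[f f_nb] := fun i => eight_neighbours (pt_triple i).
have nbf i k : nb i (f i k).
  have [Xf n0 n1 n2 fi] := (f_nb i).1 k; split=> // j.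
  by case: (ord3_shift i j) => ->.
(* The quotient of [k] by 8 selects the point of the line, the remainder one of the eight further
   lines through it. *)
exists (fun k => f (inord (k %/ 8)) (inord (k %% 8))), (fun k => inord (k %/ 8)).
split=> [k|k l neq_kl]; first exact: nbf.
rewrite (Kproj_dot (nbf _ _) (nbf _ _)).
have [eq_q|neq_q] := eqVneq (inord (k %/ 8) : 'I_3) (inord (l %/ 8)).
  rewrite eq_q (f_nb _).2 /=; first lra.
  apply: contra neq_kl => /eqP eq_m; apply/eqP/val_inj.
  have q3 (m : 'I_24) : (m %/ 8 < 3)%N by rewrite ltn_divLR // ltn_ord.
  have r8 (m : 'I_24) : (m %% 8 < 8)%N by rewrite ltn_mod.
  have := congr1 val eq_q; have := congr1 val eq_m; rewrite /= !inordK // => e1 e2.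
  by rewrite (divn_eq k 8) (divn_eq l 8) e1 e2.
have [[e _]|[e _]|] 
  := Kproj_cases (nbf (inord (k %/ 8)) (inord (k %% 8))) (nbf (inord (l %/ 8)) (inord (l %% 8))).
- by rewrite e eqxx in neq_q.
- by rewrite e eqxx in neq_q.
by rewrite (Kproj_dot (nbf _ _) (nbf _ _)) (negPf neq_q).
Qed.

Lemma nb_exists i : exists p, nb i p.
Proof.
have [f [f_nb _]] := eight_neighbours (pt_triple i).
have [Xf n0 n1 n2 fi] := f_nb 0; exists (f 0); split=> // j.
by case: (ord3_shift i j) => ->.
Qed.

(** The 24 roots together with the three e_i are 27 orthogonal vectors in a space of rank at most
    27; the coefficients of [a] on the e_i vanish. *)
Lemma frame_expansion (r : 'I_24 -> 'rV[R]_n) a :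
  (forall k l, dot (r k) (r l) = if k == l then 2 else 0) ->
  (forall k, (r k <= V)%MS) -> (forall k i, dot (r k) (e_ i) = 0) ->
  (a <= V)%MS -> (forall i, dot a (e_ i) = 0) ->
  a = \sum_k (dot a (r k) / 2) *: r k.
Proof.
move=> dot_r rV r_e aV a_e.
pose f (k : 'I_(24 + 3)) := match fintype.split k with inl l => r l | inr i => e_ i end.
have fl l : f (lshift 3 l) = r l.
  by rewrite /f (_ : fintype.split _ = inl l) //; exact: (unsplitK (inl l)).
have fr i : f (rshift 24 i) = e_ i.
  by rewrite /f (_ : fintype.split _ = inr i) //; exact: (unsplitK (inr i)).
have rkV : (\rank V <= 27)%N.
  by rewrite (leq_trans (mxrank_adds_leqif _ _).1) // (leq_add (rank_leq_row _)) ?rank_leq_row.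
have eV i : (e_ i <= V)%MS.
  rewrite scalemx_sub // addmx_sub //; first by apply/M_V/M_lift; case: (X_pt i).
  by rewrite -scaleN1r scalemx_sub ?c_V.
have splitI (k : 'I_(24 + 3)) : (exists l, k = lshift 3 l) \/ (exists i, k = rshift 24 i).
  by rewrite -(splitK k); case: (fintype.split k) => j; [left|right]; exists j.
have {1}-> := @orthogonal_expansion _ _ _ _ V f a _ _ _ rkV aV; first last.
- by move=> k; case: (splitI k) => -[j ->]; rewrite ?fl ?fr.
- move=> k; case: (splitI k) => -[j ->]; rewrite ?fl ?fr /sqnorm ?dot_r ?dot_e_e eqxx.
    by rewrite pnatr_eq0.
  by rewrite oner_eq0.
- move=> k l; case: (splitI k) => -[j ->]; case: (splitI l) => -[j' ->]; rewrite ?fl ?fr.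
  + by rewrite dot_r; case: (eqVneq j j') => // ->; rewrite eqxx.
  + by rewrite r_e.
  + by rewrite dotC r_e.
  by rewrite dot_e_e; case: (eqVneq j j') => // ->; rewrite eqxx.
rewrite big_split_ord /= [X in _ + X]big1 ?addr0 => [|i _].
  by apply: eq_bigr => k _; rewrite fl /sqnorm dot_r eqxx.
by rewrite fr a_e mul0r scale0r.
Qed.

(** Two steps away from [pt i], leaving the line. The lifts of these points are dual to the lifts of
    the [pt j]: their inner products are 1 for equal indices and 0 otherwise. *)
Lemma far_point i : exists q, X q /\ forall j, dot q (pt j) = (i == j)%:R - 1 / 3.
Proof.
have [p nbp] := nb_exists i; have [Xp neq_p pi] := nbp.
have l_p := X_lineP Xp (X_pt i) pi; have [f [f_nb _]] := eight_neighbours l_p.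
have [Xq n0 n1 n2 qp] := f_nb 0; exists (f 0); split=> // j.
have [qi _] := line_dots l_p Xq n0 n1 n2 qp.
have [<-|neq_ij] := eqVneq i j; first by rewrite qi /=; lra.
have pij : dot (pt j) (pt i) = - 4 / 3 by rewrite pt_dot eq_sym (negPf neq_ij) /=; lra.
rewrite (opposite_dot l_p Xq (X_pt j)) //=; first lra.
- by rewrite eq_sym.
- by apply: (X_neq (X_pt i) pij); lra.
by rewrite eq_sym; have [_ -> _] := nb_third nbp.
Qed.

Lemma I_span_e s : I s -> s = \sum_i dot s (e_ i) *: e_ i.
Proof.
move=> /IP[m ->]; apply: eq_bigr => i _; congr (_ *: _).
rewrite dot_suml (bigD1 i) //= dotZl dot_e_e eqxx mulr1 big1 ?addr0 // => j /negPf ji.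
by rewrite dotZl dot_e_e ji mulr0.
Qed.

Lemma K_G k : K k -> G k.
Proof.
move=> Kk; have [Mk _] := (KP k).1 Kk; apply/GP; split; first exact: Rspan_gen.
by exists 0; [apply/S_I/S_0 | rewrite add0r].
Qed.

Lemma I_u j : I (pt j)^^.
Proof. by rewrite lift_pt; apply: I_D I_c; apply: (I_Z 2); apply: I_e. Qed.

(** The glue component [s] of [a] is built explicitly in the real span of [S]; self-duality of [M]
    then gives [M (s + a)], and pairing with lifts of neighbours shows that [s] lies in [I]. *)
Lemma G_self_dual a : Rspan K a -> (forall b, G b -> dot a b \is a Num.int) -> G a.
Proof.
move=> Ra a_int; have [aV a_e] := Rspan_K Ra; apply/GP; split=> //.
have /choice[q q_far] := far_point.
have Xq j : X (q j) by case: (q_far j).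
have Mq j : M (q j)^^ by apply: M_lift; case: (Xq j).
have qu j i : dot (q j)^^ (pt i)^^ = (j == i)%:R.
  by rewrite dot_lift ?(q_far j).2; [lra | exact: Xq | exact: X_pt].
have a_u i : dot a (pt i)^^ = 0.
  exact: orth_e_I a_e (I_u i).
(* The coefficients are chosen to make [s + a] orthogonal to every lifted far point. *)
pose s := \sum_j (- dot a (q j)^^) *: (pt j)^^.
have sq j : dot s (q j)^^ = - dot a (q j)^^.
  rewrite dot_suml (bigD1 j) //= dotZl (dotC (pt j)^^) qu eqxx mulr1 big1 ?addr0 // => i ij.
  by rewrite dotZl (dotC (pt i)^^) qu eq_sym (negPf ij) mulr0.
have s_orth b : (forall i, dot b (e_ i) = 0) -> dot s b = 0.
  move=> b_e; rewrite dot_suml big1 // => j _; rewrite dotZl (dotC (pt j)^^).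
  by rewrite (orth_e_I b_e (I_u j)) mulr0.
have Msa : M (s + a).
  apply: M_self_dual => [|m Mm].
    rewrite addmx_sub // summx_sub // => j _; apply: scalemx_sub.
    by apply/M_V/M_lift; case: (X_pt j).
  have /choice[h def_h] : forall j, exists h : int, dot m (pt j)^^ = h%:~R.
    by move=> j; apply/intrP/M_int => //; apply: M_lift; case: (X_pt j).
  (* By duality of far points and line points, subtracting this combination from [m] leaves an
     element of [K]; so only pairings with [K] and with the far points matter. *)
  pose k := m - \sum_j (h j)%:~R *: (q j)^^.
  have k_u i : dot k (pt i)^^ = 0.
    rewrite dotDl dotNl dot_suml (bigD1 i) //= dotZl qu eqxx mulr1 def_h.
    by rewrite big1 ?addr0 ?subrr // => j /negPf ji; rewrite dotZl qu ji mulr0.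
  have k_c : dot k c = 0.
    by rewrite -{1}sum_lift_pt dotC dot_suml big1 // => j _; rewrite dotC k_u.
  have k_e i : dot k (e_ i) = 0 by rewrite dotZr dotDr dotNr k_u k_c subr0 mulr0.
  have Kk : K k.
    by apply/KP; split=> //; apply: MB Mm _; apply: M_sum => j; apply: MZ.
  have -> : m = k + \sum_j (h j)%:~R *: (q j)^^ by rewrite subrK.
  rewrite dotC dotDl dot_suml [X in _ + X]big1 ?addr0 => [|j _].
    by rewrite dotDr (dotC k s) s_orth // add0r (dotC k a) a_int //; apply: K_G.
  by rewrite dotZl dotDr (dotC _ s) sq (dotC _ a) addNr mulr0.
have s_int i : dot s (e_ i) \is a Num.int.
  have [p nbp] := nb_exists i; have [Gp _] := nb_root nbp.
  have : dot (s + a) p^^ \is a Num.int by apply: M_int => //; apply: M_lift; case: nbp => -[].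
  (* A lifted neighbour is a root minus e_i, so pairing it with [s + a] isolates (s, e_i) up to the
     integer (a, root). *)
  have -> : p^^ = Kproj c x y z p - e_ i by rewrite (nb_Kproj nbp) addrK.
  have s0 : dot s (Kproj c x y z p) = 0 by apply: s_orth => j; apply: Kproj_orth.
  rewrite (dotDl s) (dotDr s) (dotDr a) !dotNr a_e s0 oppr0 addr0 add0r => e.
  rewrite -[dot s _]opprK rpredN -(addrK (dot a (Kproj c x y z p)) (- _)) rpredB //.
  exact: a_int.
have /choice[m def_m] : forall i, exists m : int, dot s (e_ i) = m%:~R.
  by move=> i; apply/intrP.
exists s => //; apply/IP; exists m; rewrite {1}/s.
under eq_bigr => j _ do rewrite (I_span_e (I_u j)) scaler_sumr.
rewrite exchange_big; apply: eq_bigr => i _; rewrite -def_m dot_suml scaler_suml.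
by apply: eq_bigr => j _; rewrite dotZl scalerA.
Qed.

Lemma S_c : S c.
Proof.
rewrite -{2}sum_lift_pt; apply/SP; exists (fun=> 1).
by apply: eq_bigr => i _; rewrite scale1r.
Qed.

Lemma S_Z (k : int) s : S s -> S (k%:~R *: s).
Proof.
move=> /SP[m ->]; apply/SP; exists (fun i => k * m i); rewrite scaler_sumr.
by apply: eq_bigr => i _; rewrite scalerA intrM.
Qed.

Lemma S_2e (k : int) i : S ((2 * k)%:~R *: e_ i).
Proof.
have Su : S (pt i)^^.
  apply/SP; exists (fun j => (j == i)%:Z); rewrite (bigD1 i) //= eqxx scale1r.
  by rewrite big1 ?addr0 // => j /negPf->; rewrite scale0r.
have -> : (2 * k)%:~R *: e_ i = k%:~R *: ((pt i)^^ + (-1)%:~R *: c).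
  rewrite lift_pt rmorphN1 scaleN1r addrK [RHS]scalerA; congr (_ *: _).
  by rewrite intrM mulrC.
by apply/S_Z/S_D => //; apply/S_Z/S_c.
Qed.

(** Reduction in the four-group I/S, with [P] for membership in [S]: a parity vector of weight 0 or
    3 is represented by 0, one of weight 1 by its own index and one of weight 2 by the missing
    index. *)
Lemma small_representative (E : 'I_3 -> 'rV[R]_n) (P : set 'rV[R]_n) (b : 'I_3 -> bool) :
  P 0 -> (forall i, P (- E i - E i)) -> P (- \sum_i E i) ->
  exists2 s, s = 0 \/ (exists i, s = - E i) & P (s - \sum_i (b i)%:R *: E i).
Proof.
have sumE (F : 'I_3 -> 'rV[R]_n) : \sum_i F i = F 0 + F 1 + F 2%:R.
  rewrite !big_ord_recl big_ord0 addr0 addrA; congr (_ + F _ + F _);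
  by apply: val_inj.
rewrite !sumE => P0 PE Pd; have hd v : v = - (E 0 + E 1 + E 2%:R) -> P v by move->.
case: (b 0); case: (b 1); case: (b 2%:R); rewrite ?scale1r ?scale0r ?addr0 ?add0r.
- by exists 0; [left | apply: hd; rewrite sub0r].
- by exists (- E 2%:R); [right; exists 2%:R | apply: hd; apply/rowP => i; rewrite !mxE; lra].
- by exists (- E 1); [right; exists 1 | apply: hd; apply/rowP => i; rewrite !mxE; lra].
- by exists (- E 0); [right; exists 0 | exact: PE].
- by exists (- E 0); [right; exists 0 | apply: hd; apply/rowP => i; rewrite !mxE; lra].
- by exists (- E 1); [right; exists 1 | exact: PE].
- by exists (- E 2%:R); [right; exists 2%:R | exact: PE].
- by exists 0; [left | rewrite subr0].
Qed.

Lemma I_mod_S s : I s -> exists2 s', s' = 0 \/ (exists i, s' = - e_ i) & S (s' - s).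
Proof.
move=> /IP[m ->].
have /choice[h /choice[b m_hb]] : forall i, exists h : int, exists b : bool, m i = 2 * h + b%:Z.
  move=> i; have [h [->|->]] : exists h, m i = 2 * h \/ m i = 2 * h + 1.
  - by exists (divz (m i) 2); lia.
  - by exists h, false; rewrite addr0.
  by exists h, true.
suff [s' s'P Ss'] : exists2 s', s' = 0 \/ (exists i, s' = - e_ i) &
    S (s' - \sum_i (b i)%:R *: e_ i).
  exists s' => //.
  have -> : \sum_i (m i)%:~R *: e_ i =
      \sum_i (b i)%:R *: e_ i + \sum_i (2 * h i)%:~R *: e_ i.
    by rewrite -big_split; apply: eq_bigr => i _; rewrite m_hb intrD addrC scalerDl.
  rewrite opprD addrA; apply: S_D => //; rewrite -scaleN1r -(rmorphN1 (intmul 1)).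
  by apply: S_Z; apply: (big_ind S) => [||i _]; [exact: S_0 | exact: S_D | exact: S_2e].
have S2 i : S (- e_ i - e_ i).
  suff -> : - e_ i - e_ i = (2 * -1)%:~R *: e_ i by apply: S_2e.
  by rewrite -scaleN1r -scalerDl; congr (_ *: _); rewrite mulrN1 rmorphN /=; lra.
have := S_c; rewrite {2}c_sum_e; apply: small_representative S2; exact: S_0.
Qed.

(** The glue component may be taken to be 0 or some -e_i. If it is 0, then [a] lies in [L], against
    the minimum 4. Otherwise a - e_i has norm 3 and inner product 1 with [c], so it is p + c/3 with
    [p] in [Cp] of norm 8/3; its inner products with the line make [p] a neighbour of [pt i]. *)
Lemma root_nb a : G a -> sqnorm a = 2 -> exists i p, nb i p /\ a = Kproj c x y z p.
Proof.
move=> /GP[Ra [s Is Msa]] a2; have [_ a_e] := Rspan_K Ra.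
have [s' s'P Ss'] := I_mod_S Is.
have {s Is Msa Ss'} Msa : M (s' + a).
  have -> : s' + a = (s' - s) + (s + a) by rewrite addrA subrK.
  by apply: MD => //; apply: S_M.
have ac : dot a c = 0 by apply: orth_e_I a_e I_c.
have M_coef v : M v -> exists2 l, L l & v = l + (dot v c) *: x^^.
  move=> /glueMP[l [k [Ll ->]]]; exists l => //.
  by rewrite dotDl dotZl L_dot_c // dot_lift_c ?add0r ?mulr1 //; case: X_xyz.
case: s'P Msa => [->|[i ->]] Msa.
  move: Msa; rewrite add0r => /M_coef[l Ll]; rewrite ac scale0r addr0 => def_a.
  have := L_min.2 _ Ll; rewrite -sqnorm_eq0 -def_a a2 => /(_ _)/Wrap[|]; last lra.
  by rewrite pnatr_eq0.
have [l Ll] := M_coef _ Msa.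
rewrite dotDl ac addr0 dotNl dotC dot_c_e opprK scale1r => def_q.
have [Xx _ _ _] := X_xyz; have [p def_p] : exists p, p = l + x by exists (l + x).
have Cp_p : Cp p by apply/(CpP _ Xx.1); rewrite def_p addrK.
have pc : dot p c = 0 by apply/c_orth; case: (Cp_dual Cp_p).
have def_pe : p^^ = - e_ i + a by rewrite def_q def_p /lift3 addrA.
have Xp : X p.
  split=> //; have : dot p^^ p^^ = sqnorm p + 1 / 3.
    by rewrite /lift3 !dotDr !dotDl !dotZr !dotZl (dotC c p) pc dot_cc /sqnorm; lra.
  rewrite {1 2}def_pe !dotDl !dotDr !dotNl !dotNr a_e (dotC _ a) a_e dot_e_e eqxx.
  by rewrite -/(sqnorm a) a2 /=; lra.
have p_pt j : dot p (pt j) = 2 / 3 - 2 * (i == j)%:R.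
  have := dot_lift Xp (X_pt j); rewrite def_pe dotDl dotNl (orth_e_I a_e (I_u j)) dotC.
  by rewrite dot_lift_pt_e (eq_sym j); lra.
have nbp : nb i p.
  split=> // [j|]; last by rewrite p_pt eqxx /=; lra.
  by apply: (X_neq (X_pt j) (p_pt j)); case: (i == j) => /=; lra.
by exists i, p; split=> //; rewrite (nb_Kproj nbp) def_pe addrAC addNr add0r.
Qed.

Lemma roots_cases a b : G a -> sqnorm a = 2 -> G b -> sqnorm b = 2 ->
  [\/ a = b, a = - b | dot a b = 0].
Proof.
move=> Ga /(root_nb Ga)[i [p [nbp ->]]] Gb /(root_nb Gb)[j [q [nbq ->]]].
have [[_ ->]|[eq_ij def_q]|pq] := Kproj_cases nbp nbq.
- by constructor 1.
- by constructor 2; rewrite def_q (Kproj_third nbp) opprK.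
by constructor 3.
Qed.

(** * Frames of roots and the Niemeier lattice *)

Section RootFrame.
Variable r : 'I_24 -> 'rV[R]_n.
Hypotheses (dot_r : forall k l, dot (r k) (r l) = if k == l then 2 else 0).
Hypothesis Gr : forall k, G (r k).

Lemma frame_spans a : (a <= V)%MS -> (forall i, dot a (e_ i) = 0) ->
  a = \sum_k (dot a (r k) / 2) *: r k.
Proof.
apply: frame_expansion => // k; last by have [/Rspan_K[]] := (GP (r k)).1 (Gr k).
by have [/Rspan_K[]] := (GP (r k)).1 (Gr k).
Qed.

Lemma G_frame_spans a : G a -> a = \sum_k (dot a (r k) / 2) *: r k.
Proof. by move=> /GP[/Rspan_K[aV a_e] _]; apply: frame_spans. Qed.

(** A root is equal, opposite or orthogonal to each frame vector, and it cannot be orthogonal to all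
    since they span. *)
Lemma root_frame a : G a -> sqnorm a = 2 -> exists k, a = r k \/ a = - r k.
Proof.
move=> Ga a2; have Ea := G_frame_spans Ga.
have [[k ak]|no_k] := pselect (exists k, dot a (r k) != 0).
  exists k; have rk2 : sqnorm (r k) = 2 by rewrite /sqnorm dot_r eqxx.
  have [->|->|ak0] := roots_cases Ga a2 (Gr k) rk2; [by left | by right |].
  by rewrite ak0 eqxx in ak.
have a0 : a = 0.
  rewrite Ea big1 // => k _; have [->|nz] := eqVneq (dot a (r k)) 0.
    by rewrite mul0r scale0r.
  by case: no_k; exists k.
by move/eqP: a2; rewrite a0 /sqnorm dot0l eq_sym pnatr_eq0.
Qed.

Lemma frame_self_dual a : a = \sum_k (dot a (r k) / 2) *: r k ->
  (forall b, G b -> dot a b \is a Num.int) -> G a.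
Proof.
move=> Ea; apply: G_self_dual; rewrite Ea; apply: (big_ind (Rspan K)).
- by exists 0%N, (fun=> 0), (fun=> 0); rewrite big_ord0; split=> // -[].
- exact: Rspan_D.
by move=> k _; apply: Rspan_Z; have [] := (GP (r k)).1 (Gr k).
Qed.

Lemma root_code_self_dual : doubly_even_self_dual (frame_code r G).
Proof.
exact: (frame_code_self_dual dot_r GD GN Gr G_integral G_even G_frame_spans root_frame
  frame_self_dual).
Qed.

Lemma niemeier_of_root_frame : exists s : 'S_24, niemeier_A1_24 (r \o s) G.
Proof.
exact: (niemeier_of_frame dot_r GD GN Gr G_integral G_even G_frame_spans root_frame
  frame_self_dual).
Qed.

End RootFrame.

Lemma niemeier_exists : exists r : 'I_24 -> 'rV[R]_n, niemeier_A1_24 r G.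
Proof.
have [F [t [nbF orthF]]] := frame_exists.
have [||s rs] := @niemeier_of_root_frame (fun k => Kproj c x y z (F k)).
- move=> k l; have [->|/orthF //] := eqVneq k l.
  by have [_] := nb_root (nbF l).
- by move=> k; have [] := nb_root (nbF k).
by eexists; apply: rs.
Qed.

Lemma niemeier_frame (r : 'I_24 -> 'rV[R]_n) : niemeier_A1_24 r G ->
  (forall k l, dot (r k) (r l) = if k == l then 2 else 0) /\ forall k, G (r k).
Proof.
(* [r k] is half of 2 [r k], whose coefficients reduce to the zero codeword. *)
case=> dot_r ->; split=> // k; exists (delta_mx 0 k *+ 2); split.
  rewrite (_ : map_mx _ _ = 0); first by case: golay_closed.
  rewrite raddfMn /= map_delta_mx mulr2n; apply/rowP => l; rewrite !mxE.
  by case: (_ && _); apply: val_inj.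
rewrite -[RHS]/(half_sum r _) half_sum2 (bigD1 k) //= big1 ?addr0 => [|l lk].
  by rewrite mxE !eqxx scale1r.
by rewrite mxE (negPf lk) andbF scale0r.
Qed.

Lemma roots_card : lattice_roots G #= `I_48.
Proof.
have [r /niemeier_frame[dot_r Gr]] := niemeier_exists.
pose f (k : nat) := if (k < 24)%N then r (inord k) else - r (inord (k - 24)).
have f2 k : sqnorm (f k) = 2.
  by rewrite /f /sqnorm; case: ifP => _; rewrite ?dotNl ?dotNr ?opprK dot_r eqxx.
have -> : lattice_roots G = f @` `I_48.
  apply/seteqP; split=> [a [Ga a2]|_ [k _ <-]]; last first.
    by split=> //; rewrite /f; case: ifP => _; [|apply: GN].
  have [k [->|->]] := root_frame dot_r Gr Ga a2.
    by exists k; [apply: ltn_trans (ltn_ord k) _ | rewrite /f ltn_ord inord_val].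
  exists (k + 24)%N; first by have := ltn_ord k; rewrite /=; lia.
  by rewrite /f ltnNge leq_addl /= addnK inord_val.
have n0 : (0 == 2 :> R) = false by rewrite eq_sym pnatr_eq0.
have nN : (- 2 == 2 :> R) = false by apply/eqP; lra.
apply: inj_card_eq => k l; rewrite !inE /= => lt_k lt_l eq_f.
have /eqP : dot (f k) (f l) = 2 by rewrite eq_f -[RHS](f2 l).
rewrite /f; case: ltnP => k24; case: ltnP => l24; rewrite ?dotNl ?dotNr ?opprK dot_r;
  case: ifP => [/eqP/(congr1 (@nat_of_ord _))|_]; rewrite ?oppr0 ?n0 ?nN // /= !inordK //; lia.
Qed.

Lemma nbrs_union p :
  (nbrs X x y z x `|` nbrs X x y z y `|` nbrs X x y z z) p <-> exists i, nb i p.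
Proof.
split=> [[[|]|]|[i /nbrsP]].
- by move=> /(nbrsP 0); exists 0.
- by move=> /(nbrsP 1); exists 1.
- by move=> /(nbrsP 2%:R); exists 2%:R.
by elim/ord3_ind: i; [left; left|left; right|right].
Qed.

Lemma Kproj_bij :
  set_bij (nbrs X x y z x `|` nbrs X x y z y `|` nbrs X x y z z)
    (lattice_roots G) (Kproj c x y z).
Proof.
split.
- by move=> p /nbrs_union[i /nb_root].
- move=> p q; rewrite !inE => /nbrs_union[i nbp] /nbrs_union[j nbq] eq_pq.
  (* Equal images have inner product 2, whereas distinct neighbours give opposite or orthogonal
     roots. *)
  have := (nb_root nbq).2; rewrite /sqnorm -{1}eq_pq.
  have [[_ //]|[_ def_q]|->] := Kproj_cases nbp nbq.
    move: eq_pq; rewrite def_q (Kproj_third nbp) => eqN.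
    have := (nb_root nbp).2; rewrite eqN /sqnorm dotNl -eqN -/(sqnorm _) (nb_root nbp).2.
    by move=> e; exfalso; move: e; lra.
  by move/eqP; rewrite eq_sym pnatr_eq0.
move=> a [Ga /(root_nb Ga)[i [p [nbp ->]]]]; exists p => //.
by apply/nbrs_union; exists i.
Qed.

(* [w] is twice the projection of a point at distance 2 from [pt i] and opposite
   to the other two points of the line. *)
Lemma parity_vector i : exists2 w, G w &
  forall j p, nb j p -> exists h : int, dot w (Kproj c x y z p) = (2 * h + (i != j)%:Z)%:~R.
Proof.
have [q [Xq q_pt]] := far_point i.
have q_e j : dot q^^ (e_ j) = - 2^-1 * (i != j)%:R.
  by rewrite dot_lift_e // q_pt; case: (i == j) => /=; lra.
(* For [j] other than [i] the lift of [q] has e_j-component -1/2; adding [t] to its double removes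
   these components. *)
pose t := \sum_j (i != j)%:Z%:~R *: e_ j.
have It : I t by apply/IP; exists (fun j => (i != j)%:Z).
pose w := 2 *: q^^ + t.
have t_e j : dot t (e_ j) = (i != j)%:R.
  rewrite dot_suml (bigD1 j) //= dotZl dot_e_e eqxx mulr1 big1 ?addr0 // => k /negPf kj.
  by rewrite dotZl dot_e_e kj mulr0.
have w_e j : dot w (e_ j) = 0 by rewrite dotDl dotZl q_e t_e; lra.
have Mq : M q^^ by apply: M_lift; case: Xq.
exists w.
  apply/GP; split; last first.
    exists (- t); first exact: I_N.
    by rewrite /w addrCA addNr addr0; apply: (MZ 2).
  have n2 : (2 : R) != 0 by rewrite pnatr_eq0.
  rewrite -[w](scalerK n2); apply/Rspan_Z/Rspan_gen/KP; split=> [|j].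
    rewrite /w scalerDr; apply: MD; first by apply: (MZ 2); apply: (MZ 2).
    rewrite scaler_sumr; apply: M_sum => j; apply: S_M.
    by rewrite scalerA -(intrM _ 2); apply: S_2e.
  by rewrite dotZl w_e mulr0.
move=> j p nbp; have [Xp _ _] := nbp; have /intrP[h eh] := X_dot_int Xq Xp.
(* With h = (q, p) - 8/3 the inner product is 2((q, p) + 1/3) - [i != j] = 2(h + 3) - [i != j]. *)
exists (h + 3 - (i != j)%:Z).
rewrite (nb_Kproj nbp) dotDr w_e addr0 dotDl dotZl dot_lift // dot_suml.
rewrite (bigD1 j) //= dotZl (dotC (e_ j)) (nb_lift_e _ nbp) eqxx big1 => [|k kj]; last first.
  by rewrite dotZl dotC (nb_lift_e _ nbp) (eq_sym j) (negPf kj) oppr0 mulr0.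
rewrite !(intrD, intrM, intrN); case: (i == j) => /=; move: eh; lra.
Qed.

(** * The trio of octads *)

Section Blocks.
Variable r : 'I_24 -> 'rV[R]_n.
Hypothesis nie_r : niemeier_A1_24 r G.

Lemma dot_r k l : dot (r k) (r l) = if k == l then 2 else 0.
Proof. exact: (niemeier_frame nie_r).1. Qed.

Lemma G_r k : G (r k).
Proof. exact: (niemeier_frame nie_r).2. Qed.

Lemma colour_exists : exists col : 'I_24 -> 'I_3,
  forall k, exists p, nb (col k) p /\ r k = Kproj c x y z p.
Proof.
have /choice[col colP] : forall k, exists i p, nb i p /\ r k = Kproj c x y z p.
  by move=> k; apply: root_nb; [exact: G_r | rewrite /sqnorm dot_r eqxx].
by exists col.
Qed.

Lemma blockP (col : 'I_24 -> 'I_3) : (forall k, exists p, nb (col k) p /\ r k = Kproj c x y z p) ->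
  forall i, block X c x y z r (pt i) = finset (fun k => col k == i).
Proof.
move=> colP i; apply/finset.setP => k; rewrite !inE; have [p [nbp rk]] := colP k.
apply/asboolP/eqP => [[q /nbrsP nbq eq_pm]|<-]; last first.
  by exists p; [apply/nbrsP | rewrite rk].
have : pm (r k) (r k) by left.
have rk2 : dot (r k) (r k) = 2 by rewrite dot_r eqxx.
rewrite -eq_pm rk => kq; have [[]//|[]//|pq0] := Kproj_cases nbp nbq.
move: rk2; rewrite rk; case: kq => e; rewrite {2}e ?dotNr pq0 ?oppr0 => /eqP.
  by rewrite eq_sym pnatr_eq0.
by rewrite eq_sym pnatr_eq0.
Qed.

(** The parity vector has odd coefficients exactly outside block [i], so its codeword is the
    complement of the block; adding the all-ones word gives the block. *)
Lemma golay_blocks (col : 'I_24 -> 'I_3) i :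
  (forall k, exists p, nb (col k) p /\ r k = Kproj c x y z p) ->
  golay (\row_k (col k == i)%:R).
Proof.
move=> colP; have [w Gw w_parity] := parity_vector i.
have [_ defG] := nie_r; have := Gw; rewrite defG => -[a [golay_a def_w]].
have -> : \row_k (col k == i)%:R = map_mx intr a + const_mx 1 :> 'rV['F_2]_24.
  apply/rowP => k; rewrite !mxE; have [p [nbp rk]] := colP k.
  have [h] := w_parity _ _ nbp; rewrite -rk def_w (dot_half_sum dot_r) => /intr_inj->.
  rewrite intrD intrM eq_sym (_ : 2%:~R = 0) ?mul0r ?add0r; last exact: val_inj.
  by case: (_ == _); apply: val_inj.
by apply: golay_closed.2 => //; apply: golay_ones.
Qed.

Lemma blocks_trio : golay_trio (finset (fun O =>
  [|| O == block X c x y z r x, O == block X c x y z r y | O == block X c x y z r z])).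
Proof.
have [col colP] := colour_exists; have blockE := blockP colP.
pose b (i : 'I_3) : {set 'I_24} := finset (fun k => col k == i).
have -> : block X c x y z r x = b 0 := blockE 0.
have -> : block X c x y z r y = b 1 := blockE 1.
have -> : block X c x y z r z = b 2%:R := blockE 2%:R.
have golay_b i := golay_blocks i colP.
have supp_b i : supp (\row_k (col k == i)%:R) = b i.
  by apply/finset.setP => k; rewrite !inE mxE F2_nat_eq0 negbK.
have [_ weight _] := root_code_self_dual dot_r G_r.
have adm_b i : admissible_weight #|b i|.
  rewrite -supp_b; apply: weight; rewrite inE; apply/asboolP; rewrite nie_r.2.
  by exists (lift01 (\row_k (col k == i)%:R)); rewrite lift01K.
(* The root of a neighbour of [pt i] is, up to sign, some [r k], and that [k] has colour [i]. *)
have col_surj i : exists k, col k = i.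
  have [p nbp] := nb_exists i; have [Gp p2] := nb_root nbp.
  have [k kp] := root_frame dot_r G_r Gp p2; exists k.
  have [q [nbq rk]] := colP k; have [[->//]|[->//]|pq0] := Kproj_cases nbp nbq.
  move: p2; rewrite /sqnorm; case: kp => e; rewrite {2}e rk ?dotNr pq0 ?oppr0 => /eqP;
  by rewrite eq_sym pnatr_eq0.
have b_pos i : (0 < #|b i|)%N.
  by have [k <-] := col_surj i; apply/card_gt0P; exists k; rewrite inE.
have sum_b : (#|b 0%R| + #|b 1%R| + #|b 2%:R%R| = 24)%N.
  have : (\sum_i #|b i| = 24)%N.
    rewrite -[RHS](card_ord 24) -sum1_card (partition_big col xpredT) //=.
    by apply: eq_bigr => i _; rewrite -sum1_card; apply: eq_bigl => k; rewrite inE.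
  have sum3 (F : 'I_3 -> nat) : (\sum_i F i = F 0%R + F 1%R + F 2%:R%R)%N.
    rewrite !big_ord_recl big_ord0 addn0 addnA; congr (_ + F _ + F _)%N;
    by apply: val_inj.
  by rewrite sum3.
(* Nonempty blocks of admissible weight have at least 8 elements, and three of them share 24. *)
have b8 i : #|b i| = 8%N.
  have ge8 j : (8 <= #|b j|)%N by have := adm_b j; have := b_pos j; rewrite /admissible_weight; lia.
  have := ge8 0; have := ge8 1; have := ge8 2%:R; move: sum_b.
  by elim/ord3_ind: i; lia.
have in_P O : (O \in finset (fun O => [|| O == b 0, O == b 1 | O == b 2%:R])) =
    [exists i, O == b i].
  rewrite inE; apply/or3P/existsP => [[]|[i]]; first by exists 0.
  - by exists 1.
  - by exists 2%:R.
  by elim/ord3_ind: i; [constructor 1|constructor 2|constructor 3].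
have b_inj : injective b.
  move=> i j /finset.setP eq_b; have [k def_i] := col_surj i.
  by have := eq_b k; rewrite !inE def_i eqxx => /esym/eqP.
split.
(* The blocks are the fibres of [col], all nonempty, hence a partition. *)
- have -> : finset (fun O => [|| O == b 0, O == b 1 | O == b 2%:R]) =
      preim_partition col (finset.setTfor 'I_24).
    apply/finset.setP => O; rewrite in_P; apply/existsP/imsetP => [[i /eqP->]|[k _ ->]].
      have [k <-] := col_surj i; exists k => //; apply/finset.setP => l.
      by rewrite !inE eq_sym.
    by exists (col k); apply/eqP/finset.setP => l; rewrite !inE eq_sym.
  exact: preim_partitionP.
- rewrite -[RHS](card_ord 3) -(card_imset _ b_inj); apply: eq_card => O.
  by rewrite in_P; apply/existsP/imsetP => -[i]; [move/eqP->; exists i|move=> _ ->; exists i].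
move=> O; rewrite in_P => /existsP[i /eqP->].
by exists (\row_k (col k == i)%:R); rewrite b8; split=> //; rewrite -supp_b.
Qed.

End Blocks.

Lemma hexagon_niemeier :
  [/\ exists r : 'I_24 -> 'rV[R]_n, niemeier_A1_24 r G,
      lattice_roots G #= `I_48,
      set_bij (nbrs X x y z x `|` nbrs X x y z y `|` nbrs X x y z z)
        (lattice_roots G) (Kproj c x y z) &
      forall r : 'I_24 -> 'rV[R]_n, niemeier_A1_24 r G ->
        golay_trio (finset (fun O =>
          [|| O == block X c x y z r x, O == block X c x y z r y
            | O == block X c x y z r z]))].
Proof.
split; [exact: niemeier_exists | exact: roots_card | exact: Kproj_bij | exact: blocks_trio].
Qed.

End Hexagon.

Theorem theorem6p2 (R : realType) (n : nat) (L Cp Cm : set 'rV[R]_n)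
    (B : 'M[R]_(26, n)) (c x y z : 'rV[R]_n)
    (L_basis : lattice_basis L B)
    (L_integral : integral_lattice L)
    (L_even : even_lattice L)
    (L_det : \det (gram B) = 3)
    (L_min : lattice_min L 4)
    (L_disc : quot (dual_lattice L) L = [set L; Cp; Cm])
    (Cm_opp : Cm = [set - a | a in Cp])
    (c_norm : sqnorm c = 3)
    (c_orth : forall a, Rspan L a -> dot a c = 0)
    (X_card : hex_points Cp #= `I_819)
    (X_hex : generalized_hexagon (hex_points Cp) (hex_lines (hex_points Cp)) 2 8)
    (xyz_line : line_triple (hex_points Cp) x y z) :
  let X := hex_points Cp in
  let M := glueM L Cp Cm c in
  let G := Gamma M c x y z in
  [/\ exists r : 'I_24 -> 'rV[R]_n, niemeier_A1_24 r G,
      lattice_roots G #= `I_48,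
      set_bij (nbrs X x y z x `|` nbrs X x y z y `|` nbrs X x y z z)
        (lattice_roots G) (Kproj c x y z) &
      forall r : 'I_24 -> 'rV[R]_n, niemeier_A1_24 r G ->
        golay_trio (finset (fun O =>
          [|| O == block X c x y z r x, O == block X c x y z r y
            | O == block X c x y z r z]))].
Proof.
exact: (hexagon_niemeier L_basis L_integral L_even L_min L_disc Cm_opp c_norm c_orth
  X_hex xyz_line).
Qed.
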